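(* Let $A=\{a_1,\dots,a_n\}\subset\mathbb{Z}^d$ be a nonconfluent configuration of codimension two (so $A$ spans $\mathbb{Q}^d$ and $n=d+2$), such that no hyperplane contains all but one point of $A$ and such that the points $a_1,\dots,a_n$ are distinct. If $A$ contains an unbalanced non-splitting circuit, then $A$ is not gkz-rational.
   Context: A configuration $A=\{a_1,\dots,a_n\}\subset\mathbb{Z}^d$ spanning $\mathbb{Q}^d$ is identified with the integer $d\times n$ matrix of rank $d$ with columns $a_i$; its codimension is $m=n-d$. $A$ is nonconfluent if the vector $(1,\dots,1)$ is in the ($\mathbb{Q}$-)row span of $A$. Let $\mathcal{L}=\{v\in\mathbb{Z}^n: A\cdot v=0\}$. A Gale dual of $A$ is the configuration $B=\{b_1,\dots,b_n\}\subset\mathbb{Z}^m$ of rows of an $n\times m$ integer matrix whose columns form a $\mathbb{Z}$-basis of $\mathcal{L}$. For $I\subset\{1,\dots,n\}$ write $A(I)=\{a_i:i\in I\}$, $B(I)=\{b_i: i\in I\}$, $I^c=\{1,\dots,n\}\setminus I$. A circuit of $A$ is a minimally linearly dependent subset $A(I)$; it has a primitive integral relation $\sum_{i\in I}c_ia_i=0$ with all $c_i\neq0$, unique up to sign. The circuit $A(I)$ is balanced if the multiset $\{c_i:i\in I\}$ is symmetric around the origin (invariant, with multiplicities, under multiplication by $-1$); otherwise it is unbalanced. (In codimension two, $A(I)$ is a circuit iff $B(I^c)$ consists of all the vectors of $B$ lying on one line through the origin.) The circuit $A(I)$ is splitting if $\sum_{j\in I^c}b_j=0$, and non-splitting otherwise.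 $A$-hypergeometric functions: for $\alpha\in\mathbb{C}^d$, a function $f(x_1,\dots,x_n)$ holomorphic on an open set is $A$-hypergeometric of degree $\alpha$ if $(\partial^u-\partial^v)f=0$ for all $u,v\in\mathbb{N}^n$ with $Au=Av$, and $\sum_{j=1}^n a_{ij}x_j\partial_jf=\alpha_if$ for $i=1,\dots,d$, where $\partial^u=\partial_1^{u_1}\cdots\partial_n^{u_n}$, $\partial_j=\partial/\partial x_j$. Discriminant: $D_A\in\mathbb{Z}[x_1,\dots,x_n]$ is the sparse discriminant of $A$: the irreducible polynomial (unique up to sign) vanishing on the closure of the set of $x\in\mathbb{C}^n$ for which the generic polynomial $\sum_i x_it^{a_i}$ and all its partial derivatives in $t$ vanish simultaneously at some $t\in(\mathbb{C}^* )^d$, if this closure is a hypersurface; otherwise $D_A=1$. $A$ is gkz-rational if $D_A$ is not a monomial (in particular $D_A\ne1$) and there exists a non-zero rational $A$-hypergeometric function (of some degree $\alpha\in\mathbb{Z}^d$) whose denominator, in lowest terms, is a multiple of $D_A$. *)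

(* Defs.v *)
From HB Require Import structures.
From mathcomp Require Import all_boot all_order all_algebra.
From mathcomp Require Import classical_sets topology normedtype derive.
(* The notations of mpoly clash with those of the analysis library. *)
From mathcomp Require Import -(notations) mpoly.

Set Implicit Arguments.
Unset Strict Implicit.
Unset Printing Implicit Defensive.

Import Order.TTheory GRing.Theory Num.Theory.
Import numFieldNormedType.Exports.

Local Open Scope classical_set_scope.
Local Open Scope ring_scope.

(* A configuration of n points of Z^d is the d x n integer matrix A whose
   columns are the points. *)

Section Configurations.

Variables d n : nat.
Implicit Types (A : 'M[int]_(d, n)) (I : {set 'I_n}) (c : 'cV[int]_n).

Definition ratmx {p q : nat} (M : 'M[int]_(p, q)) : 'M[rat]_(p, q) :=
  map_mx intr M.

Definition spanning A : Prop := \rank (ratmx A) = d.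

Definition nonconfluent A : Prop :=
  ((const_mx 1 : 'rV[rat]_n) <= ratmx A)%MS.

Definition distinct_points A : Prop := injective (fun j : 'I_n => col j A).

(* The affine hyperplane {y | w *m y = h} contains a_j for j != i and does not
   contain a_i. *)
Definition all_but_one_on_hyperplane A : Prop :=
  exists (w : 'rV[rat]_d) (h : rat) (i : 'I_n),
    w != 0 /\ forall j : 'I_n, w *m col j (ratmx A) = h%:M <-> j != i.

Definition dependent A : pred {set 'I_n} :=
  fun J => ~~ free [seq col j (ratmx A) | j <- enum J].

Definition circuit A I : Prop := minset (dependent A) I.

Definition primitive_relation A I c : Prop :=
  [/\ A *m c = 0,
      forall i, (c i 0 != 0) = (i \in I)
    & \big[gcdn/0%N]_(i in I) absz (c i 0) = 1%N].

Definition balanced A I : Prop :=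
  exists2 c, primitive_relation A I c
    & perm_eq [seq c i 0 | i <- enum I] [seq - c i 0 | i <- enum I].

Definition gale_dual (m : nat) A (B : 'M[int]_(n, m)) : Prop :=
  A *m B = 0 /\
  forall v : 'cV[int]_n, A *m v = 0 -> exists! w : 'cV[int]_m, v = B *m w.

Definition splitting (m : nat) (B : 'M[int]_(n, m)) I : Prop :=
  \sum_(j in ~: I) row j B = 0.

End Configurations.

Section Divisibility.

Variable S : comUnitRingType.
Implicit Types p q g : S.

Definition divides p q : Prop := exists g, q = g * p.

Definition lowest_terms p q : Prop :=
  forall g, divides g p -> divides g q -> g \is a GRing.unit.

Definition irreducible p : Prop :=
  [/\ p != 0, p \isn't a GRing.unit
    & forall g h, p = g * h ->
        g \is a GRing.unit \/ h \is a GRing.unit].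

End Divisibility.

(* The definitions below are used for K the field of complex numbers; the
   analysis library provides complex derivatives for an arbitrary K. *)

Section PartialDerivatives.

Variables (K : numFieldType) (n : nat).
Implicit Types f : 'rV[K]_n -> K^o.

Definition partial (j : 'I_n) f : 'rV[K]_n -> K^o :=
  fun x => 'D_(delta_mx 0 j) f x.

Definition partials (u : 'cV[nat]_n) f : 'rV[K]_n -> K^o :=
  foldr (fun j => iter (u j 0) (partial j)) f (enum 'I_n).

Definition holomorphic_on (U : set 'rV[K]_n) f : Prop :=
  open U /\ forall x, U x -> differentiable f x.

End PartialDerivatives.

Section Hypergeometric.

Variables (K : numFieldType) (d n : nat).

Definition A_hypergeometric (A : 'M[int]_(d, n)) (alpha : 'cV[K]_d)
    (U : set 'rV[K]_n) (f : 'rV[K]_n -> K^o) : Prop :=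
  [/\ holomorphic_on U f,
      forall u v : 'cV[nat]_n,
        A *m map_mx Posz u = A *m map_mx Posz v ->
        forall x, U x -> partials u f x = partials v f x
    & forall (i : 'I_d) x, U x ->
        \sum_(j < n) (A i j)%:~R * x 0 j * partial j f x = alpha i 0 * f x].

End Hypergeometric.

Section Discriminant.

Variables (K : numFieldType) (d n : nat).
Implicit Types (A : 'M[int]_(d, n)) (S : set 'rV[K]_n) (x : 'rV[K]_n)
  (t : 'rV[K]_d) (D : mpoly n int).

Definition eval (p : mpoly n K) x : K := meval (x 0) p.

Definition scalars_ext D : mpoly n K := map_mpoly intr D.

Definition zariski_closure S : set 'rV[K]_n :=
  [set x | forall p, (forall y, S y -> eval p y = 0) -> eval p x = 0].

Definition hypersurface S : Prop :=
  exists p : mpoly n K,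
    [/\ p != 0, p \isn't a GRing.unit & S = [set x | eval p x = 0]].

Definition generic_poly A x : 'rV[K]_d -> K^o :=
  fun t => \sum_(j < n) x 0 j * \prod_(k < d) t 0 k ^ A k j.

Definition singular_locus A : set 'rV[K]_n :=
  [set x | exists t,
     [/\ forall k, t 0 k != 0, generic_poly A x t = 0
       & forall k, partial k (generic_poly A x) t = 0]].

(* D is the A-discriminant, which is only defined up to sign. *)
Definition discriminant A D : Prop :=
  let Z := zariski_closure (singular_locus A) in
  (hypersurface Z /\ irreducible D /\
     forall x, Z x -> eval (scalars_ext D) x = 0)
  \/ (~ hypersurface Z /\ D = 1).

Definition monomial D : Prop :=
  exists (c : int) (u : multinom n), D = c *: mpolyX int u.

(* The rational function is P / Q. *)
Definition gkz_rational A : Prop :=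
  exists2 D, discriminant A D &
    ~ monomial D /\
    exists (alpha : 'cV[int]_d) (P Q : mpoly n K) (U : set 'rV[K]_n),
      [/\ P != 0, lowest_terms P Q,
          divides (scalars_ext D) Q,
          U !=set0 /\ (forall x, U x -> eval Q x != 0)
        & A_hypergeometric A (map_mx intr alpha) U
            (fun x => eval P x / eval Q x)].

End Discriminant.

(* Main.v *)
Require Import Defs.
From HB Require Import structures.
From mathcomp Require Import all_boot all_order all_algebra.
From mathcomp Require Import complex.
From mathcomp Require Import boolp classical_sets functions reals topology.
From mathcomp Require Import normedtype derive.
From mathcomp Require Import -(notations) mpoly.
From mathcomp Require Import zify ring.

(** A rational hypergeometric function [f = P / Q] of integral degree is
    homogeneous, so [f = a / b] with [a] and [b] homogeneous
    ([homogeneous_fraction]). In codimension two the lattice of relations has a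
    basis consisting of the relation [cc] of the circuit and a second vector
    [bb] ([circuit_frame_exists]); with [z1 = x ^ cc] and [z2 = x ^ bb], the
    function [f] is a monomial times a rational function [F] of [z1] and [z2].

    The circuit operator does not see [z2]: each coefficient [h] of the
    expansion of [F] in powers of [z2] satisfies an ordinary equation
    [P1 (theta) h = z1 * P2 (theta) h], where the roots of [P1] are, up to
    integers, all the [cc j]-division points for the positive [cc j], and those
    of [P2] the same for the negative ones ([circuit_recurrence]). The power
    series in [z1] of a rational solution obeys a first order recurrence and
    also one with constant coefficients. If it is infinite, this forces the
    roots of [P1] and [P2] to agree modulo the integers
    ([hypergeometric_recurrent]), and then the circuit is balanced
    ([facp_counts], [counts_perm]). So in the unbalanced case every [h] is a
    polynomial in [z1] ([circuit_expansion]).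

    By Fatou's lemma [F] can then be written with a denominator [q2] whose
    constant term in [z2] is a unit ([fatou]). Going back to the variables [x],
    unique factorization shows that [Q], being in lowest terms, divides the
    rehomogenization [Q'] of [q2] ([lowest_terms_dvd]).

    The kernel of [A] lies in the singular locus defining the discriminant
    ([kernel_singular_locus]), so [Q], and with it [Q'], vanishes on all kernel
    vectors [cc + eps * bb]. When [eps] tends to [0] the coordinates off the
    circuit tend to [0]; the circuit being non-splitting, the sign of [bb] can
    be chosen such that [z2] tends to [0], while [z1] keeps a nonzero limit. The
    leading term of [Q'] in [eps] then comes from the constant term of [q2] and
    is not zero ([rehom_kernel_line_neq0]), a contradiction. *)

Set Implicit Arguments.
Unset Strict Implicit.
Unset Printing Implicit Defensive.
Import Order.TTheory GRing.Theory Num.Theory.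
Local Open Scope ring_scope.

(** * Unique factorization *)

Section Factorial.

Variable R : idomainType.
Implicit Types (p a b : R) (s : seq R).

Definition prime_elt p : Prop :=
  [/\ p != 0, p \isn't a GRing.unit
    & forall a b, divides p (a * b) -> divides p a \/ divides p b].

Definition factorial_ring : Prop := forall a, a != 0 ->
  exists u s, [/\ u \is a GRing.unit, forall p, p \in s -> prime_elt p
    & a = u * \prod_(p <- s) p].

Lemma divides_mull p a b : divides p b -> divides p (a * b).
Proof. by move=> [g ->]; exists (a * g); rewrite mulrA. Qed.

Lemma divides_mulr p a b : divides p a -> divides p (a * b).
Proof. by rewrite mulrC; apply: divides_mull. Qed.

Lemma dividesD p a b : divides p a -> divides p b -> divides p (a + b).
Proof. by move=> [g ->] [h ->]; exists (g + h); rewrite mulrDl. Qed.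

Lemma dividesN p a : divides p a -> divides p (- a).
Proof. by move=> [g ->]; exists (- g); rewrite mulNr. Qed.

Lemma divides0 p : divides p 0.
Proof. by exists 0; rewrite mul0r. Qed.

Lemma divides_sum p (J : Type) (r : seq J) (P : pred J) (F : J -> R) :
  (forall i, P i -> divides p (F i)) -> divides p (\sum_(i <- r | P i) F i).
Proof.
move=> h; apply: (big_ind (divides p)) => //; first exact: divides0.
exact: dividesD.
Qed.

Lemma prime_not_dvd_unit p u : prime_elt p -> u \is a GRing.unit ->
  ~ divides p u.
Proof.
by move=> [_ /negP np _] hu [g eu]; apply: np; move: hu; rewrite eu unitrM => /andP[].
Qed.

(** A proper divisor of a prime is a unit, so in a product of primes any prime
    divisor can be cancelled against one of the factors. *)
Lemma cancel_prime p b u s : prime_elt p -> u \is a GRing.unit ->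
  (forall q, q \in s -> prime_elt q) -> b * p = u * \prod_(q <- s) q ->
  exists u' s', [/\ u' \is a GRing.unit, forall q, q \in s' -> prime_elt q,
    (size s' < size s)%N & b = u' * \prod_(q <- s') q].
Proof.
move=> pp hu; have [p0 pnu pP] := pp.
elim: s b => [|q s IH] b hs.
  rewrite big_nil mulr1 => e; case: (prime_not_dvd_unit pp hu).
  by exists b.
rewrite big_cons => e.
have hs' : forall q, q \in s -> prime_elt q.
  by move=> x xs; apply: hs; rewrite inE xs orbT.
have pq : prime_elt q by apply: hs; rewrite mem_head.
have [q0 qnu qP] := pq.
have : divides p (q * (u * \prod_(j <- s) j)).
  by exists b; rewrite e mulrCA.
case/pP => [[v qv]|[b' eb']].
  have [[w vw]|[w pw]] : divides q v \/ divides q p.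
    by apply: qP; exists 1; rewrite mul1r.
    have e1 : w * p = 1.
      by apply: (mulfI q0); rewrite mulrA [q * w]mulrC -vw -qv mulr1.
    by case/negP: pnu; apply/unitrP; exists w; rewrite [p * w]mulrC.
  have e1 : w * v = 1.
    by apply: (mulIf p0); rewrite -mulrA -qv -pw mul1r.
  have vu : v \is a GRing.unit by apply/unitrP; exists w; rewrite [v * w]mulrC.
  exists (u * v), s; split => //; first by rewrite unitrM hu.
  apply: (mulIf p0); rewrite e qv; ring.
have [u' [s' [hu' hs'' lts eb]]] := IH b' hs' (esym eb').
exists u', (q :: s'); split => //.
  by move=> x; rewrite inE => /predU1P[->|/hs''].
apply: (mulIf p0); rewrite e big_cons mulrCA eb' eb; ring.
Qed.

Lemma factorial_prime_dvd a : factorial_ring -> a != 0 ->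
  a \isn't a GRing.unit -> exists2 p, prime_elt p & divides p a.
Proof.
move=> fR a0 nu; have [u [[|p s] [hu hs ea]]] := fR a a0.
  by move: nu; rewrite ea big_nil mulr1 hu.
exists p; first by apply: hs; rewrite mem_head.
by rewrite ea big_cons mulrCA; apply: divides_mulr; exists 1; rewrite mul1r.
Qed.

(** Euclid's lemma: a common prime factor of the two terms is excluded, so
    each prime factor of [Q] has to come from [T]. *)
Lemma lowest_terms_dvd (P Q T : R) : factorial_ring -> lowest_terms P Q ->
  Q != 0 -> divides Q (T * P) -> divides Q T.
Proof.
move=> fR PQ Q0; have [u [s [hu hs eQ]]] := fR Q Q0.
have {PQ} : forall p, prime_elt p -> divides p P -> ~ divides p Q.
  by move=> p [_ /negP np _] dP dQ; apply: np; apply: PQ.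
move: eQ {Q0}; elim: s hs Q T => [|p s IH] hs Q T eQ cop.
  move: eQ; rewrite big_nil mulr1 => -> _.
  by exists (T / u); rewrite divrK.
have pp : prime_elt p by apply: hs; rewrite mem_head.
have [p0 _ pP] := pp.
have pQ : divides p Q.
  by rewrite eQ big_cons mulrCA; apply: divides_mulr; exists 1; rewrite mul1r.
move=> [g eg]; have : divides p (T * P) by rewrite eg; apply: divides_mull.
case/pP => [[T' eT]|/(cop _ pp)//].
have hs' : forall q, q \in s -> prime_elt q.
  by move=> q qs; apply: hs; rewrite inE qs orbT.
have eQ' : Q = u * (\prod_(q <- s) q) * p by rewrite eQ big_cons; ring.
have [||h eh] := IH hs' (u * \prod_(q <- s) q) T' erefl.
- move=> q pq dP dQ; apply: (cop q pq dP); rewrite eQ'.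
  exact: divides_mulr.
- exists g; apply: (mulIf p0); rewrite -[RHS]mulrA -eQ' -eg eT; ring.
by exists h; rewrite eT eh eQ'; ring.
Qed.

End Factorial.

Lemma field_factorial (F : fieldType) : factorial_ring F.
Proof.
by move=> a a0; exists a, [::]; rewrite big_nil mulr1 unitfE.
Qed.

Section FactorialPoly.

Variable R : idomainType.
Implicit Types (p : R) (f g h : {poly R}).

Lemma dividesP p : p != 0 -> forall f,
  divides p%:P f <-> forall i, divides p f`_i.
Proof.
move=> p0 f; split=> [[g ->] i|dv]; first by exists g`_i; rewrite coefMC.
have [q hq] := choice dv.
exists (\poly_(i < size f) q i); apply/polyP=> i.
rewrite coefMC coef_poly; case: ltnP => [_|le]; first exact: hq.
by rewrite mul0r nth_default.
Qed.

Lemma min_not_dvd p f : p != 0 -> ~ divides p%:P f -> exists2 i,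
  ~ divides p f`_i & forall j, (j < i)%N -> divides p f`_j.
Proof.
move=> p0 nd.
have ex : exists i, `[< ~ divides p f`_i >].
  apply/not_existsP => h; apply: nd; apply/(dividesP p0) => i.
  by apply: contrapT => n; apply: (h i); apply/asboolP.
exists (ex_minn ex); first by case: ex_minnP => m /asboolP.
case: ex_minnP => m _ mm j ltj; apply: contrapT => n.
by have := mm j; rewrite leqNgt ltj => /(_ (asboolT n)).
Qed.

(** Modulo a prime [p] the lowest surviving terms of two factors multiply to
    the lowest surviving term of the product. The bound [k] makes this usable
    for power series known up to some order. *)
Lemma dvd_coefM p f g i k : prime_elt p ->
  ~ divides p f`_i -> (forall j, (j < i)%N -> divides p f`_j) ->
  (forall j, (j <= i + k)%N -> divides p (f * g)`_j) ->
  forall j, (j <= k)%N -> divides p g`_j.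
Proof.
move=> pp nf lf dfg; elim/ltn_ind => j IH lejk.
have [p0 _ pP] := pp.
have := dfg (i + j)%N; rewrite leq_add2l => /(_ lejk).
rewrite coefM.
have ii : (i < (i + j).+1)%N by rewrite ltnS leq_addr.
rewrite (bigD1 (Ordinal ii)) //= addKn => dsum.
have : divides p (f`_i * g`_j).
  set S := (X in _ + X) in dsum.
  have -> : f`_i * g`_j = (f`_i * g`_j + S) - S by rewrite addrK.
  apply: dividesD => //; apply/dividesN/divides_sum => l nl.
  have [lt|gt|e] := ltngtP l i; first exact/divides_mulr/lf.
    apply/divides_mull/IH; have := ltn_ord l; lia.
  by case/eqP: nl; apply/val_inj.
by case/pP.
Qed.

Lemma prime_polyC p : prime_elt p -> prime_elt p%:P.
Proof.
move=> pp; have [p0 pnu pP] := pp; split.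
- by rewrite polyC_eq0.
- by rewrite poly_unitE size_polyC p0 coefC.
move=> f g dfg; have [//|nf] := EM (divides p%:P f); first by left.
right; apply/(dividesP p0) => j.
have [i ni li] := min_not_dvd p0 nf.
apply: (dvd_coefM pp ni li _ (leqnn j)) => l _.
by move/(dividesP p0): dfg; apply.
Qed.

Definition primitive_poly f : Prop :=
  forall p, prime_elt p -> ~ divides p%:P f.

Hypothesis fR : factorial_ring R.

(** Dividing out primes terminates, since each of them also leaves the leading
    coefficient. *)
Lemma primitive_part f : f != 0 -> exists s g,
  [/\ forall p, p \in s -> prime_elt p, primitive_poly g
    & f = (\prod_(p <- s) p)%:P * g].
Proof.
move=> f0; have l0 : lead_coef f != 0 by rewrite lead_coef_eq0.
have [u [s [hu hs e]]] := fR l0.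
have [k lek] := ubnP (size s).
elim: k => // k IH in f f0 l0 u s hu hs e lek *.
have [pf|npf] := EM (primitive_poly f).
  by exists [::], f; rewrite big_nil mul1r.
have [p [pp [g ef]]] : exists p, prime_elt p /\ divides p%:P f.
  apply: contrapT => h; apply: npf => p pp dp; apply: h; by exists p.
have g0 : g != 0 by apply: contraNneq f0 => g0; rewrite ef g0 mul0r.
have [|u' [s' [hu' hs' lts eb]]] := cancel_prime (b := lead_coef g) pp hu hs.
  by rewrite -e ef lead_coefM lead_coefC.
have [||t [h [ht ph eg]]] := IH g g0 _ u' s' hu' hs' eb.
- by rewrite lead_coef_eq0.
- by apply: leq_trans lts _; rewrite -ltnS.
exists (p :: t), h; split => //.
  by move=> x; rewrite inE => /predU1P[->|/ht].
by rewrite ef eg big_cons polyCM; ring.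
Qed.

Lemma primitive_divl f g : primitive_poly (f * g) -> primitive_poly g.
Proof. by move=> pr p pp d; apply: (pr p pp); apply: divides_mull. Qed.

Lemma primitive_const (c : R) : primitive_poly c%:P -> c != 0 ->
  c \is a GRing.unit.
Proof.
move=> pc c0; apply: contrapT => /negP nu.
have [p pp [g e]] := factorial_prime_dvd fR c0 nu.
by apply: (pc p pp); exists g%:P; rewrite -polyCM -e.
Qed.

(** Pseudo-divisibility, that is divisibility over the fraction field, by a
    primitive polynomial is divisibility: the primes of the denominator cancel
    one by one. *)
Lemma primitive_dvdp f g : primitive_poly g -> g %| f -> divides g f.
Proof.
move=> pg /Pdiv.WeakIdomain.dvdpP[[c q] /= c0 e].
have [u [s [hu hs ec]]] := fR c0; move: e; rewrite {}ec {c0}.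
elim: s hs q => [|p s IH] hs q.
  rewrite big_nil mulr1 => e; exists (u^-1 *: q).
  by rewrite -scalerAl -e scalerA mulVr ?scale1r.
have pp : prime_elt p by apply: hs; rewrite mem_head.
have [p0 _ _] := pp; have [_ _ pP] := prime_polyC pp.
rewrite big_cons => e.
have : divides p%:P (q * g).
  exists ((u * \prod_(x <- s) x) *: f).
  by rewrite -e [RHS]mulrC mul_polyC scalerA; congr (_ *: _); ring.
case/pP => [[q' eq]|/(pg _ pp)//].
apply: (IH _ q') => [x xs|]; first by apply: hs; rewrite inE xs orbT.
have pP0 : p%:P != 0 by rewrite polyC_eq0.
apply: (mulfI pP0); rewrite mulrA [_ * q']mulrC -eq -e mul_polyC scalerA.
by congr (_ *: _); ring.
Qed.

(** Over the fraction field an irreducible polynomial is prime; a primitive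
    part of its gcd with a factor brings any splitting found there back to
    [R]. *)
Lemma primitive_irreducible_prime g : g != 0 -> primitive_poly g ->
  (1 < size g)%N ->
  (forall a b, g = a * b -> (1 < size a)%N -> (1 < size b)%N -> False) ->
  prime_elt g.
Proof.
move=> g0 pg szg irr; split=> //.
  by rewrite poly_unitE gtn_eqF.
move=> a b dab; have dab' : g %| a * b.
  by case: dab => h ->; apply: dvdp_mull.
have [cop|ncop] := boolP (coprimep g a).
  right; apply: primitive_dvdp => //; by rewrite -(Pdiv.Idomain.Gauss_dvdpr _ cop).
left; have e0 : gcdp g a != 0 by rewrite gcdp_eq0 negb_and g0.
have [s [h [hs ph eh]]] := primitive_part e0.
set c := \prod_(p <- s) p in eh.
have c0 : c != 0 by apply: contraNneq e0 => z; rewrite eh z mul0r.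
have eqe : gcdp g a %= h.
  by rewrite eh mul_polyC; apply: eqp_scale.
have h0 : h != 0 by apply: contraNneq e0 => z; rewrite eh z mulr0.
have [r er] : divides h g.
  by apply: primitive_dvdp => //; rewrite -(eqp_dvdl _ eqe) dvdp_gcdl.
have [q eq] : divides h a.
  by apply: primitive_dvdp => //; rewrite -(eqp_dvdl _ eqe) dvdp_gcdr.
have szh : (1 < size h)%N.
  move: ncop; rewrite /coprimep (eqp_size eqe).
  by rewrite neq_ltn ltnS leqn0 size_poly_eq0 (negPf h0).
have szr : (size r <= 1)%N.
  by rewrite leqNgt; apply/negP => szr; apply: (irr r h).
have r0 : r != 0 by apply: contraNneq g0 => z; rewrite er z mul0r.
have er' := size1_polyC szr.
have ru : r`_0 \is a GRing.unit.
  apply: primitive_const; last by apply: contraNneq r0; rewrite {2}er' => ->.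
  by rewrite -er'; apply: (@primitive_divl h); rewrite mulrC -er.
move: ru er'; set r0' := r`_0 => ru er'; exists (q * (r0'^-1)%:P).
rewrite er er' eq -!mulrA; congr (_ * _).
by rewrite mulrA -polyCM mulVr // mul1r.
Qed.

Lemma primitive_factors g : g != 0 -> primitive_poly g ->
  exists (u : {poly R}) (t : seq {poly R}), [/\ u \is a GRing.unit,
    forall q, q \in t -> prime_elt q & g = u * \prod_(q <- t) q].
Proof.
have [k lek] := ubnP (size g).
elim: k => // k IH in g lek *; move=> g0 pg.
have [szg|szg] := leqP (size g) 1.
  have eg := size1_polyC szg; have c0 : g`_0 != 0.
    by apply: contraNneq g0; rewrite {2}eg => ->.
  exists g, [::]; rewrite big_nil mulr1; split => //.
  rewrite eg rmorph_unit //; apply: primitive_const => //.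
  by rewrite -eg.
have [[a [b [eg sza szb]]]|irr] :=
  EM (exists a b, [/\ g = a * b, (1 < size a)%N & (1 < size b)%N]); last first.
  exists 1, [:: g]; rewrite big_seq1 mul1r unitr1; split => // p.
  rewrite inE => /eqP ->; apply: primitive_irreducible_prime => // a b e sa sb.
  by apply: irr; exists a, b.
have a0 : a != 0 by rewrite -size_poly_gt0 ltnW.
have b0 : b != 0 by rewrite -size_poly_gt0 ltnW.
have := lek; rewrite eg size_mul // => lek'.
have [||u [s [hu hs ea]]] := IH a _ a0; first by lia.
  by apply: (@primitive_divl b); rewrite mulrC -eg.
have [||v [t [hv ht eb]]] := IH b _ b0; first by lia.
  by apply: (@primitive_divl a); rewrite -eg.
exists (u * v), (s ++ t); split; first by rewrite unitrM hu.
  by move=> p; rewrite mem_cat => /orP[/hs|/ht].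
rewrite big_cat /=;
by rewrite [in LHS]ea [in LHS]eb mulrACA.
Qed.

(** Gauss: the content is factored in [R] and the primitive part by degree. *)
Lemma factorial_poly : factorial_ring {poly R}.
Proof.
move=> f f0; have [s [g [hs pg ef]]] := primitive_part f0.
have g0 : g != 0 by apply: contraNneq f0 => z; rewrite ef z mulr0.
have [u [t [hu ht eg]]] := primitive_factors g0 pg.
exists u, ([seq p%:P | p <- s] ++ t); split => //.
  move=> p; rewrite mem_cat => /orP[/mapP[q /hs pq ->]|/ht//].
  exact: prime_polyC.
by rewrite big_cat big_map /= {1}ef {1}eg rmorph_prod mulrCA.
Qed.

End FactorialPoly.

Lemma factorial_iso (R S : idomainType) (f : {rmorphism R -> S})
  (g : {rmorphism S -> R}) : cancel f g -> cancel g f ->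
  factorial_ring S -> factorial_ring R.
Proof.
move=> fK gK fS a a0.
have [|u [s [hu hs e]]] := fS (f a).
  by rewrite -(rmorph0 f) (inj_eq (can_inj fK)).
exists (g u), [seq g p | p <- s]; split; first exact: rmorph_unit.
  move=> _ /mapP[p /hs [p0 pnu pP] ->]; split.
  - by rewrite -(rmorph0 g) (inj_eq (can_inj gK)).
  - by apply: contraNN pnu => /(rmorph_unit f); rewrite gK.
  move=> x y [z e']; have : divides p (f x * f y).
    by exists (f z); rewrite -rmorphM e' rmorphM gK.
  by case/pP => [[w ew]|[w ew]]; [left|right]; exists (g w);
    rewrite -rmorphM -ew fK.
by rewrite big_map -rmorph_prod -rmorphM -e fK.
Qed.

Local Notation MX i := (mpolyX _ (mnm1 i)).

Lemma mpoly_rmorph_ext n (K : comNzRingType) (S : comNzRingType)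
    (f g : {rmorphism mpoly n K -> S}) :
  (forall c, f (mpolyC n c) = g (mpolyC n c)) ->
  (forall i, f (MX i) = g (MX i)) -> f =1 g.
Proof.
move=> fgC fgX p; rewrite [p]mpolyE !rmorph_sum; apply: eq_bigr => m _.
rewrite -mul_mpolyC !rmorphM fgC mpolyXE_id !rmorph_prod; congr (_ * _).
by apply: eq_bigr => i _; rewrite !rmorphXn fgX.
Qed.

(** Induction on the number of variables: [f] reads a polynomial as one in the
    last variable, and [g] is its inverse. *)
Lemma factorial_mpoly n (K : fieldType) : factorial_ring (mpoly n K).
Proof.
elim: n => [|n IH].
  pose f : {rmorphism mpoly 0 K -> K} := meval (fun=> 0).
  pose g : {rmorphism K -> mpoly 0 K} := @mpolyC 0 K.
  apply: (@factorial_iso _ _ f g _ _ (@field_factorial K)).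
    by move=> p; rewrite [p]nvar0_mpolyC /f /g /= mevalC.
  by move=> c; rewrite /f /g /= mevalC.
pose f : {rmorphism mpoly n.+1 K -> {poly (mpoly n K)}} := @muni n K.
pose g : {rmorphism {poly (mpoly n K)} -> mpoly n.+1 K} :=
  horner_eval (MX ord_max) \o map_poly (@mwiden n K).
have gC c : g c%:P = mwiden c by rewrite /g /= map_polyC horner_evalE hornerC.
have gX : g 'X = MX ord_max by rewrite /g /= map_polyX horner_evalE hornerX.
have fC c : f (mpolyC _ c) = (mpolyC _ c)%:P by exact: muniC.
have fM : f (MX ord_max) = 'X.
  rewrite /f /= /muni mmapX mmap1U; case: splitP => // j /= e.
  by have := ltn_ord j; rewrite -e ltnn.
have wX j : mwiden (MX j) = MX (widen_ord (leqnSn n) j) :> mpoly n.+1 K.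
  by rewrite mwidenX mnmwiden1.
have fW j : f (MX (widen_ord (leqnSn n) j)) = (MX j)%:P.
  rewrite /f /= /muni mmapX mmap1U; case: splitP => [k /= e|k /= e].
    by congr (MX _)%:P; apply/val_inj.
  by have := ltn_ord j; lia.
apply: (@factorial_iso _ _ f g _ _ (factorial_poly IH)).
  apply: (@mpoly_rmorph_ext _ _ _ (g \o f) idfun) => [c|i].
    by change (g (f (mpolyC _ c)) = mpolyC _ c); rewrite fC gC mwidenC.
  change (g (f (MX i)) = MX i); have [lt|ge] := ltnP i n.
    have -> : i = widen_ord (leqnSn n) (Ordinal lt) by apply/val_inj.
    by rewrite fW gC wX.
  have -> : i = ord_max by apply/val_inj => /=; have := ltn_ord i; lia.
  by rewrite fM gX.
have fg c : f (g c%:P) = c%:P.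
  rewrite gC; move: c.
  apply: (@mpoly_rmorph_ext _ _ _ (f \o @mwiden n K) polyC) => [c|i].
    by change (f (mwiden (mpolyC n c)) = (mpolyC n c)%:P); rewrite mwidenC fC.
  by change (f (mwiden (MX i)) = (MX i)%:P); rewrite wX fW.
elim/poly_ind => [|p c IHp]; first by rewrite !rmorph0.
by rewrite !rmorphD !rmorphM IHp gX fM fg.
Qed.

(** * Hypergeometric sequences with a constant coefficient recurrence *)

Section HypergeometricSequences.

Variable K : numFieldType.
Implicit Types (a b t p q chi : {poly K}) (c : nat -> K) (rho : K).

Definition shiftp k p := p \Po ('X + k%:R%:P).

Lemma shiftpE k p x : (shiftp k p).[x] = p.[x + k%:R].
Proof. by rewrite /shiftp horner_comp !hornerE. Qed.

Lemma size_shiftp k p : size (shiftp k p) = size p.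
Proof. by rewrite size_comp_poly2 // size_XaddC. Qed.

Lemma lead_shiftp k p : lead_coef (shiftp k p) = lead_coef p.
Proof. by rewrite lead_coef_comp ?size_XaddC // lead_coefXaddC expr1n mulr1. Qed.

Lemma shiftp_eq0 k p : (shiftp k p == 0) = (p == 0).
Proof. by rewrite -!size_poly_eq0 size_shiftp. Qed.

Lemma shiftpM k p q : shiftp k (p * q) = shiftp k p * shiftp k q.
Proof. exact: comp_polyM. Qed.

Lemma shiftp_comp k l p : shiftp k (shiftp l p) = shiftp (k + l) p.
Proof.
rewrite /shiftp -comp_polyA comp_polyD comp_polyX comp_polyC.
by rewrite -addrA -polyCD -natrD.
Qed.

Lemma poly_nat_roots p m0 :
  (forall m, (m0 <= m)%N -> p.[m%:R] = 0) -> p = 0.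
Proof.
move=> h; apply/eqP; apply: contraT => p0.
have := @max_poly_roots K p [seq (m0 + i)%:R | i <- iota 0 (size p)] p0.
rewrite size_map size_iota ltnn; apply.
  by apply/allP => _ /mapP[i _ ->]; apply/eqP/h/leq_addr.
rewrite map_inj_uniq ?iota_uniq // => i j /eqP.
by rewrite eqr_nat eqn_add2l => /eqP.
Qed.

Lemma size_sub_lead p q : p != 0 -> size p = size q ->
  lead_coef p = lead_coef q -> (size (p - q)%R < size p)%N.
Proof.
move=> p0 sz ld; have sp : (0 < size p)%N by rewrite size_poly_gt0.
rewrite -(prednK sp) ltnS; apply/leq_sizeP => j lej.
rewrite coefB; have [->|ne] := eqVneq j (size p).-1.
  by rewrite {2}sz -!/(lead_coef _) ld subrr.
have le' : (size p <= j)%N.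
  by move: lej ne; case: (size p) sp => //= n _; rewrite neq_ltn; lia.
by rewrite !nth_default ?subrr // -sz.
Qed.

Let size_mulK p q : p != 0 -> q != 0 -> size (p * q)%R = (size p + size q).-1.
Proof. exact: size_mul. Qed.

(** The action of [chi] as a linear recurrence operator on sequences, the
    variable acting as the shift. *)
Definition recur chi c m := \sum_(i < size chi) chi`_i * c (m + i)%N.

Lemma recurE chi c m n : (size chi <= n)%N ->
  recur chi c m = \sum_(i < n) chi`_i * c (m + i)%N.
Proof.
move=> le; rewrite /recur (big_ord_widen n (fun i => chi`_i * c (m + i)%N) le).
rewrite big_mkcond /=; apply: eq_bigr => i _; case: ltnP => // h.
by rewrite nth_default // mul0r.
Qed.

Lemma recurD p q c m : recur (p + q) c m = recur p c m + recur q c m.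
Proof.
pose n := maxn (size p) (size q).
rewrite (@recurE _ _ _ n) ?size_polyD // (@recurE p _ _ n) ?leq_maxl //.
rewrite (@recurE q _ _ n) ?leq_maxr // -big_split /=.
by apply: eq_bigr => i _; rewrite coefD mulrDl.
Qed.

Lemma recurZ k p c m : recur (k *: p) c m = k * recur p c m.
Proof.
rewrite (@recurE _ _ _ (size p)) ?size_scale_leq // /recur mulr_sumr.
by apply: eq_bigr => i _; rewrite coefZ mulrA.
Qed.

Lemma recurX p c m : recur (p * 'X) c m = recur p c m.+1.
Proof.
have le : (size (p * 'X)%R <= (size p).+1)%N.
  by apply: leq_trans (size_polyMleq _ _) _; rewrite size_polyX; lia.
rewrite (recurE _ _ le) big_ord_recl coefMX mul0r add0r /recur.
by apply: eq_bigr => i _; rewrite coefMX /= addSnnS.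
Qed.

Lemma recur_sum n (F : 'I_n -> {poly K}) c m :
  recur (\sum_i F i) c m = \sum_i recur (F i) c m.
Proof.
apply: (big_morph (fun p => recur p c m)) => [p q|]; first exact: recurD.
by rewrite /recur size_poly0 big_ord0.
Qed.

Variables (a b : {poly K}) (c : nat -> K) (m0 : nat).
Hypotheses (b0 : b != 0) (sab : size a = size b).
Hypothesis hyp : forall m, (m0 <= m)%N -> c m.+1 * b.[m%:R] = a.[m%:R] * c m.
Hypothesis cn0 : forall m, (m0 <= m)%N -> c m != 0.

(** The limit of the ratio of consecutive terms. *)
Let rho := lead_coef a / lead_coef b.

(** The powers of [X - rho] applied to [c]. As [c] is hypergeometric, [diffs
    s] is [c] times a rational function, with numerator [diffnum s] and
    denominator [diffden s]. *)
Fixpoint diffs s m :=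
  if s is s'.+1 then diffs s' m.+1 - rho * diffs s' m else c m.

Fixpoint diffnum s :=
  if s is s'.+1 then
    a * shiftp 1 (diffnum s') - rho *: (shiftp s' b * diffnum s')
  else 1.

Definition diffden s := \prod_(l < s) shiftp l b.

Let a0 : a != 0.
Proof. by rewrite -size_poly_eq0 sab size_poly_eq0. Qed.

Let rho0 : rho != 0.
Proof. by rewrite mulf_neq0 ?invr_eq0 ?lead_coef_eq0. Qed.

Let diffdenS s : diffden s.+1 = b * shiftp 1 (diffden s).
Proof.
rewrite /diffden big_ord_recl /= {1}/shiftp addr0 comp_polyXr; congr (_ * _).
have e1 : shiftp 1 1 = 1 by rewrite /shiftp comp_polyC.
rewrite (big_morph (shiftp 1) (shiftpM 1) e1); apply: eq_bigr => i _.
by rewrite shiftp_comp.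
Qed.

Lemma diffsE s m : (m0 <= m)%N ->
  (diffden s).[m%:R] * diffs s m = (diffnum s).[m%:R] * c m.
Proof.
elim: s m => [|s IH] m lem; first by rewrite /diffden big_ord0 /= !hornerE.
have h1 := IH m.+1 (leqW lem); have h2 := IH m lem.
have e1 : (diffden s.+1).[m%:R] = b.[m%:R] * (diffden s).[m.+1%:R].
  by rewrite diffdenS hornerM shiftpE natr1.
have e2 : (diffden s.+1).[m%:R] = (diffden s).[m%:R] * b.[(m + s)%:R].
  by rewrite /diffden big_ord_recr /= hornerM shiftpE natrD.
rewrite [diffs _ _]/= [diffnum _]/= mulrBr {1}e1 e2 -mulrA h1.
rewrite hornerD hornerN hornerZ !hornerM !shiftpE natr1 -natrD.
transitivity ((diffnum s).[m.+1%:R] * (c m.+1 * b.[m%:R])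
   - rho * b.[(m + s)%:R] * ((diffden s).[m%:R] * diffs s m)); first by ring.
by rewrite h2 hyp //; ring.
Qed.

(** By the choice of [rho] the leading terms of the two products cancel: the
    degree of the rational function drops at each step. *)
Lemma size_diffnum s : diffnum s != 0 ->
  (size (diffnum s.+1) < size (diffnum s) + (size b).-1)%N.
Proof.
move=> t0 /=; set p := a * _; set q := rho *: _.
have p0 : p != 0 by rewrite mulf_neq0 // shiftp_eq0.
have szp : size p = (size (diffnum s) + (size b).-1)%N.
  rewrite size_mulK ?shiftp_eq0 // size_shiftp sab.
  have sb : (0 < size b)%N by rewrite size_poly_gt0.
  by lia.
have szq : size q = size p.
  rewrite szp [LHS]size_scale // size_mulK ?shiftp_eq0 // size_shiftp.
  have sb : (0 < size b)%N by rewrite size_poly_gt0.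
  by lia.
rewrite -szp; apply: size_sub_lead => //.
rewrite lead_coefZ !lead_coefM !lead_shiftp /rho; field.
by rewrite lead_coef_eq0.
Qed.

(** If moreover [c] satisfies a linear recurrence with constant coefficients,
    expand it in powers of [X - rho]: were no [diffnum s] zero, its terms would
    have strictly decreasing degrees and could not cancel. At the first
    vanishing [diffnum] the ratio of [c] is, up to a constant and a shift,
    that of a rational function and its translate. *)
Lemma hypergeometric_recurrent chi m1 : chi != 0 ->
  (forall m, (m1 <= m)%N -> recur chi c m = 0) ->
  exists t s, t != 0 /\ a * shiftp 1 t = rho *: (shiftp s b * t).
Proof.
move=> chi0 hchi.
have [[s [ts0 ts]]|nv] := EM (exists s, diffnum s != 0 /\ diffnum s.+1 = 0).
  by exists (diffnum s), s; split => //; apply/eqP; rewrite -subr_eq0; apply/eqP.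
have tn0 s : diffnum s != 0.
  elim: s => [|s IH]; first exact: oner_neq0.
  by apply/eqP => z; apply: nv; exists s.
pose chi' := chi \Po ('X + rho%:P).
have chi'0 : chi' != 0 by rewrite -size_poly_eq0 size_comp_poly2 ?size_XaddC // size_poly_eq0.
have echi : chi = \sum_(s < size chi') chi'`_s *: ('X - rho%:P) ^+ s.
  by rewrite -comp_polyE comp_polyXaddC_K.
have recs s m : recur (('X - rho%:P) ^+ s) c m = diffs s m.
  elim: s m => [|s IH] m.
    by rewrite /recur expr0 size_poly1 big_ord1 coefC mul1r addn0.
  rewrite exprSr mulrBr recurD recurX mulrC mul_polyC -scaleNr recurZ !IH /=.
  by rewrite mulNr.
set S := size chi' in echi.
pose T s := chi'`_s *: (diffnum s * \prod_(s <= l < S) shiftp l b).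
have sumT : \sum_(s < S) T s = 0.
  apply: (@poly_nat_roots _ (maxn m0 m1)) => m; rewrite geq_max => /andP[lm0 lm1].
  apply: (mulIf (cn0 lm0)); rewrite mul0r horner_sum mulr_suml.
  have := hchi m lm1; rewrite echi recur_sum => /(congr1 ( *%R (diffden S).[m%:R])).
  rewrite mulr0 mulr_sumr => e; rewrite -[RHS]e; apply: eq_bigr => s _.
  rewrite recurZ recs /T hornerZ hornerM.
  have -> : (diffden S).[m%:R] = (diffden s).[m%:R] *
     (\prod_(s <= l < S) shiftp l b).[m%:R].
    rewrite -hornerM /diffden -!(big_mkord xpredT (fun l => shiftp l b)).
    by rewrite -big_cat_nat //= ltnW.
  set y := (\prod_(_ <= _ < _) _).[_].
  transitivity (chi'`_s * y * ((diffnum s).[m%:R] * c m)); first by ring.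
  by rewrite -(diffsE s lm0); ring.
have [s0 cs0 mins0] : exists2 s, chi'`_s != 0 & forall j, (j < s)%N -> chi'`_j = 0.
  have ex : exists s, chi'`_s != 0.
    by exists S.-1; rewrite -/(lead_coef _) lead_coef_eq0.
  exists (ex_minn ex); first by case: ex_minnP.
  move=> j; case: ex_minnP => s _ h lt; apply/eqP; apply: contraTT lt => /h.
  by rewrite -leqNgt.
have ltS : (s0 < S)%N.
  by rewrite ltnNge; apply: contra cs0 => le; rewrite nth_default.
pose N := (size b).-1.
pose M s := (size (diffnum s) + (S - s) * N)%N.
have szP s k : (size (diffnum s * \prod_(s <= l < s + k) shiftp l b)%R
    = size (diffnum s) + k * N)%N /\ \prod_(s <= l < s + k) shiftp l b != 0.
  elim: k => [|k [IH IH0]]; first by rewrite addn0 big_geq // mulr1 oner_neq0 addn0.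
  have p0 : \prod_(s <= l < s + k.+1) shiftp l b != 0.
    by rewrite addnS big_nat_recr ?leq_addr //= mulf_neq0 ?shiftp_eq0.
  split=> //; rewrite addnS big_nat_recr ?leq_addr //= mulrA.
  rewrite size_mulK ?mulf_neq0 ?shiftp_eq0 // IH size_shiftp /N.
  have sb : (0 < size b)%N by rewrite size_poly_gt0.
  have ar x n j : (0 < n -> (x + j * n.-1 + n).-1 = x + j.+1 * n.-1)%N.
    by case: n => // n _; rewrite addnS mulSn /= addnCA [RHS]addnC addnC.
  exact: ar.
have szT s : (s < S)%N -> (size (T s) <= M s)%N.
  move=> lt; apply: leq_trans (size_scale_leq _ _) _.
  by have := (szP s (S - s)%N).1; rewrite subnKC ?(ltnW lt) // => ->.
have szT0 : size (T s0) = M s0.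
  rewrite [LHS]size_scale //.
  by have := (szP s0 (S - s0)%N).1; rewrite subnKC ?(ltnW ltS) // => ->.
have decM s : (s < S)%N -> (M s.+1 < M s)%N.
  move=> lt; have := size_diffnum (tn0 s); rewrite -/N /M => h.
  have -> : (S - s = (S - s.+1).+1)%N by lia.
  have ar x y n : (x < y + n -> x + (S - s.+1) * n < y + (S - s.+1).+1 * n)%N.
    by rewrite mulSn addnA ltn_add2r.
  exact: ar.
have dec k : (s0 + k < S)%N -> (0 < k)%N -> (M (s0 + k)%N < M s0)%N.
  elim: k => // k IH lt _; rewrite addnS in lt *.
  apply: leq_trans (decM _ (ltnW lt)) _.
  by case: k IH lt => [|k] IH lt; rewrite ?addn0 // ltnW // IH // ltnW.
have := sumT; rewrite (bigD1 (Ordinal ltS)) //= => /eqP.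
rewrite addr_eq0 => /eqP /(congr1 (fun p : {poly K} => size p)).
rewrite [RHS]size_polyN szT0 => e.
have : (M s0 <= (M s0).-1)%N.
  rewrite [X in (X <= _)%N]e; apply: (leq_trans (size_sum _ _ _)).
  apply/bigmax_leqP => s ne.
  have [lt|gt|es] := ltngtP s s0.
  - by rewrite /T mins0 // scale0r size_poly0.
  - apply: leq_trans (szT s (ltn_ord s)) _.
    have := dec (s - s0)%N; rewrite subnKC ?(ltnW gt) // => /(_ (ltn_ord s)).
    by rewrite subn_gt0 => /(_ gt); lia.
  - by case/eqP: ne; apply/val_inj.
have : (0 < M s0)%N by rewrite /M addn_gt0 size_poly_gt0 tn0.
by lia.
Qed.

End HypergeometricSequences.

(** * Roots of factorial products modulo the integers *)

Section UnbalancedProducts.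

Variables (K : numFieldType) (n : nat) (cc : 'I_n -> int).
Implicit Types (e : 'I_n -> int) (P : pred 'I_n).

Definition linp (c e : int) : {poly K} := c%:~R *: 'X + (e%:~R)%:P.

(** The factorial-type product whose roots are, for each [j], a full set of
    representatives of the [|cc j|]-division points modulo integers. *)
Definition facp P e : {poly K} :=
  \prod_(j | P j) \prod_(i < absz (cc j)) linp (cc j) (e j - i%:Z).

Lemma linpE (c e : int) x : (linp c e).[x] = c%:~R * x + e%:~R.
Proof. by rewrite /linp !hornerE. Qed.

Lemma size_linp (c e : int) : c != 0 -> size (linp c e) = 2%N.
Proof.
move=> c0; have c0' : c%:~R != 0 :> K by rewrite intr_eq0.
have sX : size (c%:~R *: 'X : {poly K}) = 2%N by rewrite size_scale ?size_polyX.
rewrite /linp size_polyDl sX // size_polyC.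
by case: eqP.
Qed.

Lemma linp_neq0 (c e : int) : c != 0 -> linp c e != 0.
Proof. by move=> c0; rewrite -size_poly_eq0 size_linp. Qed.

Lemma shift_linp k (c e : int) : shiftp k (linp c e) = linp c (e + c * k%:Z).
Proof.
rewrite /shiftp /linp comp_polyD comp_polyC comp_polyZ comp_polyX scalerDr.
rewrite -addrA; congr (_ + _).
rewrite -mul_polyC -polyCM -polyCD; congr (_%:P).
by rewrite rmorphD rmorphM /= addrC.
Qed.

Lemma shift_facp k P e :
  shiftp k (facp P e) = facp P (fun j => e j + cc j * k%:Z).
Proof.
have m1 : shiftp k 1 = 1 :> {poly K} by rewrite /shiftp comp_polyC.
rewrite /facp (big_morph (shiftp k) (shiftpM k) m1); apply: eq_bigr => j _.
rewrite (big_morph (shiftp k) (shiftpM k) m1); apply: eq_bigr => i _.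
by rewrite shift_linp; congr linp; ring.
Qed.

Lemma facp_neq0 P e : (forall j, P j -> cc j != 0) -> facp P e != 0.
Proof.
move=> h; apply/prodf_neq0 => j Pj; apply/prodf_neq0 => i _.
by apply/linp_neq0/h.
Qed.

Lemma size_facp P e : (forall j, P j -> cc j != 0) ->
  size (facp P e) = (\sum_(j | P j) absz (cc j)).+1.
Proof.
move=> h.
have sP (I : finType) (Q : pred I) (F : I -> {poly K}) (s : I -> nat) :
    (forall i, Q i -> size (F i) = (s i).+1) ->
    size (\prod_(i | Q i) F i) = (\sum_(i | Q i) s i).+1.
  move=> hF; rewrite size_prod => [|i Qi]; last by rewrite -size_poly_eq0 hF.
  rewrite (eq_bigr (fun i => s i + 1)%N) => [|i Qi]; last by rewrite hF ?addn1.
  by rewrite big_split /= sum1_card -addSn addnK.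
apply: (sP _ P _ _) => j Pj; rewrite (sP _ _ _ (fun=> 1%N)) => [|i _].
  by rewrite sum_nat_const card_ord muln1.
by rewrite size_linp ?h.
Qed.

Lemma mup_linp (c e : int) x : c != 0 ->
  mup x (linp c e) = root (linp c e) x :> nat.
Proof.
move=> c0; have c0' : c%:~R != 0 :> K by rewrite intr_eq0.
have [|nz] := boolP (root _ x); last exact: mupNroot.
rewrite /root linpE => /eqP z.
have -> : linp c e = c%:~R%:P * ('X - x%:P) ^+ 1.
  rewrite expr1 mulrBr mul_polyC -polyCM /linp; congr (_ + _).
  by rewrite -polyCN; congr _%:P; apply/eqP; rewrite -addr_eq0 addrC z.
by rewrite mupMr ?mup_XsubCX ?eqxx // rootC.
Qed.

Lemma mup_facp P e x : (forall j, P j -> cc j != 0) ->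
  mup x (facp P e) =
  (\sum_(j | P j) \sum_(i < absz (cc j))
     root (linp (cc j) (e j - i%:Z)%R) x)%N.
Proof.
have mupP (I : eqType) (r : seq I) (Q : pred I) (F : I -> {poly K}) :
    (forall i, Q i -> F i != 0) ->
    mup x (\prod_(i <- r | Q i) F i) = (\sum_(i <- r | Q i) mup x (F i))%N.
  move=> F0; elim: r => [|i r IH].
    by rewrite !big_nil mupNroot // root1.
  rewrite !big_cons; case: ifP => // Qi; rewrite mupM ?IH ?F0 //.
  by rewrite prodf_seq_neq0; apply/allP => k _; apply/implyP/F0.
move=> h; rewrite /facp mupP => [|j Pj]; last first.
  by apply/prodf_neq0 => i _; apply/linp_neq0/h.
apply: eq_bigr => j Pj; rewrite mupP => [|i _]; last by apply/linp_neq0/h.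
by apply: eq_bigr => i _; rewrite mup_linp // h.
Qed.

(** The points of the class of [1/N] modulo the integers lying in a window of
    half-width [W], indexed from [0]. *)
Definition wpt (N W k : nat) : K := N%:R^-1 + (k%:Z - W%:Z)%:~R.

Lemma root_wpt (N W k : nat) (c e : int) : (0 < N)%N ->
  root (linp c e) (wpt N W k) =
  (c * (1 + N%:Z * (k%:Z - W%:Z)) + N%:Z * e == 0).
Proof.
move=> N0; have N0' : N%:R != 0 :> K by rewrite pnatr_eq0 -lt0n.
rewrite /root linpE -(inj_eq (mulfI N0')) mulr0 -(intr_eq0 K); congr (_ == 0).
by rewrite /wpt !(rmorphD, rmorphM) /=; field.
Qed.

(** If [c = N * c'], a root condition reads [i = e + c' + c * n]: it
    determines [i] as a residue modulo [c], and then [n]. If [N] does not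
    divide [c] it has no solution, [N] being coprime to [1 + N * n]. *)
Lemma count_wpt (N W : nat) (c e : int) : (0 < N)%N -> c != 0 ->
  (absz e + 2 < W)%N ->
  (\sum_(k < W.*2.+1) \sum_(i < absz c)
    root (linp c (e - i%:Z)%R) (wpt N W k))%N = (N %| absz c)%N.
Proof.
move=> N0 c0 hW; rewrite pair_big /=.
under eq_bigr => p _ do rewrite root_wpt //.
have [dv|ndv] := boolP (N %| absz c)%N; last first.
  rewrite big1 // => -[k i] _ /=; apply/eqP; rewrite eqb0; apply: contra ndv.
  move=> /eqP e0.
  have -> : (N %| absz c)%N = (N%:Z %| c)%Z by rewrite dvdzE absz_nat.
  apply/dvdzP; exists (- (e - i%:Z) - c * (k%:Z - W%:Z)).
  by apply/eqP; rewrite -subr_eq0 -[X in _ == X]e0; apply/eqP; ring.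
have /dvdzP[c' ec] : (N%:Z %| c)%Z by rewrite dvdzE absz_nat.
have [i0 [q [lti0 d0]]] : exists (i0 : nat) (q : int),
    (i0 < absz c)%N /\ e + c' = q * c + i0%:Z.
  exists (absz ((e + c') %% c)%Z), ((e + c') %/ c)%Z.
  rewrite gez0_abs ?modz_ge0 // -divz_eq; split => //.
  by rewrite -ltz_nat gez0_abs ?modz_ge0 //; apply: ltz_mod.
have qb : (absz q * absz c <= absz e + absz c + absz c)%N.
  have := dvdn_leq _ dv; rewrite absz_gt0 => /(_ c0) leN.
  have : (absz c' <= absz c)%N by rewrite ec abszM leq_pmulr.
  by rewrite -abszM; lia.
have qb' : (absz q <= absz e + 2)%N.
  have c1 : (0 < absz c)%N by rewrite absz_gt0.
  rewrite leqNgt; apply/negP => gt.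
  have : ((absz e + 3) * absz c <= absz q * absz c)%N.
    by rewrite leq_mul2r; apply/orP; right; lia.
  have : (absz e <= absz e * absz c)%N by rewrite leq_pmulr.
  by rewrite mulnDl; lia.
have ltk0 : (absz (W%:Z - q) < W.*2.+1)%N by lia.
pose p0 := (Ordinal ltk0, Ordinal lti0).
have key k i : (c * (1 + N%:Z * (k%:Z - W%:Z)) + N%:Z * (e - i%:Z) == 0)
    = (i%:Z == e + c' + c * (k%:Z - W%:Z)).
  have N0' : N%:Z != 0 by rewrite -lt0n.
  rewrite -[RHS](inj_eq (mulfI N0')) -[RHS]subr_eq0 -[RHS]oppr_eq0.
  by congr (_ == 0); rewrite ec; ring.
rewrite (bigD1 p0) //= big1 => [|[k i] ne]; rewrite key.
  have -> : (absz (W%:Z - q))%:Z = W%:Z - q by rewrite gez0_abs; lia.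
  by rewrite addn0 (_ : e + c' + _ = i0%:Z) ?eqxx // d0; ring.
case: eqP => // e0; case/eqP: ne; move: (ltn_ord k) (ltn_ord i) => ltk lti.
have e1 : i%:Z - i0%:Z = c * (q + (k%:Z - W%:Z)) by rewrite e0 d0; ring.
have eq1 : q + (k%:Z - W%:Z) = 0.
  apply/eqP; apply: contraT => nz.
  have : (absz c <= absz (i%:Z - i0%:Z)%R)%N.
    by rewrite e1 abszM leq_pmulr // absz_gt0.
  by clear -lti lti0; lia.
congr pair; apply/val_inj => /=; first by clear -eq1; lia.
by move: e1; rewrite eq1 mulr0; clear; lia.
Qed.

Lemma sum_telescope (F G g : nat -> nat) m :
  (forall k, F k + g k.+1 = G k + g k)%N -> g 0%N = 0%N -> g m = 0%N ->
  (\sum_(k < m) F k = \sum_(k < m) G k)%N.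
Proof.
move=> h g0 gm.
suff : (\sum_(k < m) F k + g m = \sum_(k < m) G k + g 0)%N.
  by rewrite gm g0 !addn0.
elim: m {gm} => [|m IH]; first by rewrite !big_ord0.
by rewrite !big_ord_recr /= -addnA h addnCA IH addnCA addnA.
Qed.

Lemma mup_shift1 (t : {poly K}) x : t != 0 ->
  mup x (shiftp 1 t) = mup (x + 1) t.
Proof.
move=> t0; have [m [q nr et]] := multiplicity_XsubC t (x + 1).
rewrite t0 /= in nr.
have q0 : q != 0 by apply: contraNneq nr => ->; rewrite root0.
have -> : shiftp 1 t = shiftp 1 q * ('X - x%:P) ^+ m.
  rewrite et shiftpM; congr (_ * _); rewrite /shiftp rmorphXn /=; congr (_ ^+ _).
  by rewrite comp_polyB comp_polyX comp_polyC polyCD; ring.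
rewrite et !mupMr ?mup_XsubCX ?eqxx // /root shiftpE.
by rewrite mulr1n.
Qed.

(** The factors [t] and [t(X+1)] have the same multiplicities along a class
    modulo integers, hence so have the two products; counting the roots in the
    class of [1/N] detects divisibility by [N]. *)
Lemma facp_counts (P Q : pred 'I_n) e e' (t : {poly K}) s (rho : K) N :
  (forall j, P j -> cc j != 0) -> (forall j, Q j -> cc j != 0) ->
  t != 0 -> rho != 0 -> (0 < N)%N ->
  facp P e * shiftp 1 t = rho *: (shiftp s (facp Q e') * t) ->
  (\sum_(j | P j) (N %| absz (cc j)) = \sum_(j | Q j) (N %| absz (cc j)))%N.
Proof.
move=> hP hQ t0 rho0 N0; rewrite shift_facp.
set e'' := fun j => _ + _ => E.
pose W0 := (\max_j (absz (e j) + absz (e'' j) + 3))%N.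
(* The window is chosen so wide that it contains all roots of the products in
   the class and that [t] has no root at its two ends. *)
have [W [leW nr]] : exists W, (W0 <= W)%N /\
    ~~ root t (wpt N W 0) && ~~ root t (wpt N W W.*2.+1).
  apply: contrapT => no.
  pose t' := (t \Po (- 'X + (N%:R^-1)%:P)) * (t \Po ('X + (N%:R^-1 + 1)%:P)).
  have t'0 : t' != 0.
    have sN : size (- 'X + (N%:R^-1)%:P : {poly K}) = 2%N.
      rewrite size_polyDl size_polyN size_polyX // size_polyC.
      by case: (_ != _).
    by rewrite mulf_neq0 // -size_poly_eq0 size_comp_poly2 ?size_XaddC ?size_poly_eq0.
  case/eqP: t'0; apply: (@poly_nat_roots _ _ W0) => W leW.
  apply/eqP; apply: contraT => nz; case: no; exists W; split => //.
  move: nz; rewrite /t' hornerM !horner_comp mulf_eq0 negb_or /root.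
  rewrite !hornerE /wpt !(rmorphD, rmorphN) /= => /andP[n1 n2].
  have e1 : N%:R^-1 + (0 + - W%:R) = - W%:R + N%:R^-1 :> K by ring.
  have e2 : N%:R^-1 + ((W.*2.+1)%:R + - W%:R) = W%:R + N%:R^-1 + 1 :> K.
    by rewrite -addnn -natr1 natrD; ring.
  by rewrite -!pmulrn e1 e2 n1 n2.
have mE k : (mup (wpt N W k) (facp P e) + mup (wpt N W k.+1) t =
   mup (wpt N W k) (facp Q e'') + mup (wpt N W k) t)%N.
  have -> : wpt N W k.+1 = wpt N W k + 1.
    rewrite /wpt -addrA; congr (_ + _); rewrite -[1]/(1%:~R) -rmorphD /=.
    by congr (_%:~R); lia.
  rewrite -mup_shift1 // -!mupM ?shiftp_eq0 ?facp_neq0 // E.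
  by rewrite -mul_polyC [LHS]mupMr // rootC.
have cnt (R : pred 'I_n) f : (forall j, R j -> cc j != 0) ->
    (forall j, (absz (f j) + 2 < W)%N) ->
    (\sum_(k < W.*2.+1) mup (wpt N W k) (facp R f) =
     \sum_(j | R j) (N %| absz (cc j)))%N.
  move=> hR hf.
  rewrite (eq_bigr _ (fun (k : 'I_W.*2.+1) _ => mup_facp f (wpt N W k) hR)).
  by rewrite exchange_big /=; apply: eq_bigr => j Rj; rewrite count_wpt ?hR.
have leW' j : (absz (e j) + absz (e'' j) + 3 <= W)%N.
  exact: leq_trans (leq_bigmax j) leW.
have /andP[n1 n2] := nr.
have := sum_telescope mE (mupNroot n1) (mupNroot n2).
by rewrite (cnt P) ?(cnt Q) // => j; have := leW' j; clear; lia.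
Qed.

(** Descending from the largest entry, the numbers of multiples of each [N]
    determine the multiplicity of each positive integer. *)
Lemma counts_perm :
  (forall N, (0 < N)%N -> \sum_(j | (0 < cc j)%R) (N %| absz (cc j))
     = \sum_(j | (cc j < 0)%R) (N %| absz (cc j)))%N ->
  perm_eq [seq cc j | j <- enum 'I_n] [seq - cc j | j <- enum 'I_n].
Proof.
move=> h; pose M := (\max_j absz (cc j))%N.
pose cnt (P : pred 'I_n) k := (\sum_(j | P j) (absz (cc j) == k))%N.
have cntE (P : pred 'I_n) N : (forall j, P j -> cc j != 0) -> (0 < N)%N ->
   (\sum_(j | P j) (N %| absz (cc j)) = \sum_(k < M.+1 | (0 < k) && (N %| k)) cnt P k)%N.
  move=> hP N0; rewrite exchange_big /=; apply: eq_bigr => j Pj.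
  have lt : (absz (cc j) < M.+1)%N by rewrite ltnS; apply: (leq_bigmax j).
  have [dv|ndv] := boolP (N %| _)%N.
    rewrite (bigD1 (Ordinal lt)) /=; last by rewrite absz_gt0 hP.
    rewrite eqxx big1 // => k /andP[_ ne].
    by apply/eqP; rewrite eqb0; apply: contra ne => /eqP e; apply/eqP/val_inj.
  rewrite big1 // => k /andP[_ dk]; apply/eqP; rewrite eqb0.
  by apply: contra ndv => /eqP ->.
pose pos := [pred j | 0 < cc j]; pose neg := [pred j | cc j < 0].
have cpn k : (0 < k)%N -> cnt pos k = cnt neg k.
  have [m lem] := ubnP (M.+1 - k)%N; elim: m k lem => // m IH k lem k0.
  have [gtM|leM] := ltnP M k.
    have z (P : pred 'I_n) : cnt P k = 0%N.
      rewrite /cnt big1 // => j _; apply/eqP; rewrite eqb0 neq_ltn.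
      have leM := leq_bigmax (F := fun j => absz (cc j)) j.
      by rewrite (leq_ltn_trans leM gtM).
    by rewrite !z.
  have hp j : pos j -> cc j != 0 by rewrite /pos /= lt_def => /andP[].
  have hn j : neg j -> cc j != 0 by rewrite /neg /= lt_neqAle => /andP[].
  have := h k k0; rewrite (cntE pos k hp k0) (cntE neg k hn k0).
  have ltk : (k < M.+1)%N by [].
  rewrite (bigD1 (Ordinal ltk)) ?k0 ?dvdnn //= [in RHS](bigD1 (Ordinal ltk)) ?k0 ?dvdnn //=.
  rewrite [X in (_ + X)%N](eq_bigr (fun i : 'I_M.+1 => cnt neg i))
    => [/addIn //|i /andP[/andP[i0 dk] ne]].
  apply: IH => //; have := dvdn_leq i0 dk; rewrite leq_eqVlt => /predU1P[e|ltki].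
    by case/eqP: ne; apply/val_inj.
  by have := ltn_ord i; lia.
have cz (z : int) : 0 < z ->
    (\sum_j (cc j == z) = \sum_j (cc j == - z)%R)%N.
  move=> z0; have := cpn (absz z); rewrite absz_gt0 gt_eqF // => /(_ isT).
  rewrite /cnt big_mkcond [in RHS]big_mkcond /= => e.
  rewrite (eq_bigr (fun j => if pos j then nat_of_bool (absz (cc j) == absz z)
      else 0%N)) => [|j _].
    rewrite e; apply: eq_bigr => j _; rewrite /neg /=.
    have -> : (cc j == - z) = (cc j < 0) && (absz (cc j) == absz z) by lia.
    by case: (cc j < 0).
  have -> : (cc j == z) = (0 < cc j) && (absz (cc j) == absz z) by lia.
  by rewrite /pos /=; case: (0 < cc j).
apply/allP => z _ /=; apply/eqP.
have cE (f : 'I_n -> int) : count_mem z [seq f j | j <- enum 'I_n] = (\sum_j (f j == z))%N.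
  rewrite count_map -sum1_count big_mkcond /= big_enum /=.
  by apply: eq_bigr => j _; case: eqP.
rewrite !cE; under [in RHS]eq_bigr => j _ do rewrite eqr_oppLR.
have [lt|gt|<-] := ltgtP 0 z; [exact: cz| |by rewrite oppr0].
by rewrite [RHS]cz ?opprK // oppr_gt0.
Qed.

End UnbalancedProducts.

(** * Power series obeying an unbalanced recurrence *)

Lemma poly_nat_nonroots (K : numFieldType) (p : {poly K}) : p != 0 ->
  exists M, forall m, (M <= m)%N -> p.[m%:R] != 0.
Proof.
move=> p0; apply: contrapT => no.
have hs k : exists s : seq nat, [/\ uniq s, size s = k
    & all (fun m => root p m%:R) s].
  elim: k => [|k [s [us ss rs]]]; first by exists [::].
  have [m [ltm rm]] : exists m, (\max_(i <- s) i < m)%N /\ root p m%:R.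
    apply: contrapT => no'; apply: no; exists (\max_(i <- s) i).+1 => m lem.
    by apply/negP => rm; apply: no'; exists m.
  exists (m :: s); rewrite /= ss rm us rs andbT; split=> //.
  apply: contraL ltm => ms; rewrite -leqNgt.
  exact: (leq_bigmax_seq (F := fun i => i) (P := xpredT) m ms).
have [s [us ss rs]] := hs (size p).
have := @max_poly_roots K p [seq m%:R | m <- s] p0.
rewrite size_map ss ltnn => contra; suff : false by [].
apply: contra; first by rewrite all_map.
by rewrite map_inj_uniq // => i j /eqP; rewrite eqr_nat => /eqP.
Qed.

(** If one large coefficient vanishes, the recurrence makes the series a
    polynomial. Otherwise its coefficients form a hypergeometric sequence with
    a constant coefficient recurrence, so the two products have the same roots
    modulo the integers, which amounts to balance. *)
Lemma unbalanced_series_divides (K : numFieldType) n (cc e : 'I_n -> int)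
    (q r : {poly K}) (c : nat -> K) :
  \sum_j cc j = 0 ->
  ~ perm_eq [seq cc j | j <- enum 'I_n] [seq - cc j | j <- enum 'I_n] ->
  q`_0 != 0 ->
  (forall m, \sum_(i < m.+1) q`_i * c (m - i)%N = r`_m) ->
  (forall m, (facp K cc [pred j | 0 < cc j] e).[m.+1%:R] * c m.+1
           = (facp K cc [pred j | cc j < 0] e).[m%:R] * c m) ->
  exists h, r = q * h.
Proof.
move=> sc unb q0 hr hc.
set pos := [pred j | 0 < cc j] in hc; set neg := [pred j | cc j < 0] in hc.
have hp j : pos j -> cc j != 0 by rewrite /pos /= lt_def => /andP[].
have hn j : neg j -> cc j != 0 by rewrite /neg /= lt_neqAle => /andP[].
pose a : {poly K} := facp K cc neg e; pose b : {poly K} := shiftp 1 (facp K cc pos e).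
have b0 : b != 0 by rewrite shiftp_eq0 facp_neq0.
have sab : size a = size b.
  rewrite size_shiftp !size_facp //; congr _.+1.
  have PoszS (P : pred 'I_n) : (\sum_(j | P j) absz (cc j))%N%:Z
      = \sum_j (if P j then (absz (cc j))%:Z else 0).
    by rewrite (big_morph Posz PoszD (erefl _)) big_mkcond.
  have e1 : (\sum_(j | neg j) absz (cc j))%N%:Z -
      (\sum_(j | pos j) absz (cc j))%N%:Z = - \sum_j cc j.
    rewrite !PoszS -sumrB -sumrN; apply: eq_bigr => j _; rewrite /neg /pos /=.
    by case: (ltrgtP 0 (cc j)); lia.
  by apply/eqP; rewrite -eqz_nat -subr_eq0 e1 sc oppr0.
have hyp m : c m.+1 * b.[m%:R] = a.[m%:R] * c m.
  by rewrite mulrC -hc /b shiftpE natr1.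
have [M hM] := poly_nat_nonroots b0.
have [[m1 [lem1 z]]|nz] := EM (exists m, (M <= m)%N /\ c m = 0).
  have zc m : (m1 <= m)%N -> c m = 0.
    elim: m => [|m IH]; first by rewrite leqn0 => /eqP <-.
    rewrite leq_eqVlt => /predU1P[<- //|lt].
    have := hyp m; rewrite IH // mulr0 => /eqP; rewrite mulf_eq0.
    by rewrite (negPf (hM _ _)) ?orbF ?(leq_trans lem1) // => /eqP.
  exists (\poly_(i < m1) c i); apply/polyP => m; rewrite -hr coefM.
  apply: eq_bigr => i _; rewrite coef_poly; case: ltnP => // le.
  by rewrite zc.
have cn0 m : (M <= m)%N -> c m != 0.
  by move=> le; apply/eqP => z; apply: nz; exists m.
pose L := (size q).-1.
pose chi := \poly_(i < L.+1) q`_(L - i).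
have chi0 : chi != 0.
  apply/eqP => /polyP/(_ L); rewrite coef_poly ltnSn subnn coef0.
  by apply/eqP.
have rec m : (size r <= m)%N -> recur chi c m = 0.
  move=> le; rewrite (@recurE _ _ _ _ L.+1) ?size_poly //.
  transitivity r`_(m + L); last by rewrite nth_default // (leq_trans le) ?leq_addr.
  rewrite -hr -addnS -(big_mkord xpredT (fun i => q`_i * c (m + L - i)%N)).
  rewrite (big_cat_nat (n := L.+1)) ?leq_addl //=.
  rewrite [X in _ = _ + X]big_nat_cond [X in _ = _ + X]big1 => [|i].
    rewrite addr0 big_mkord (reindex_inj rev_ord_inj) /=; apply: eq_bigr => i _.
    have := ltn_ord i; rewrite ltnS coef_poly subSS => lei.
    by rewrite ltnS leq_subr subKn // addnBA.
  rewrite andbT => /andP[ltL _]; rewrite nth_default ?mul0r //.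
  by apply: leq_trans ltL; rewrite /L; case: (size q).
have [t [s [t0 E]]] :=
  hypergeometric_recurrent b0 sab (fun m (_ : (M <= m)%N) => hyp m) cn0 chi0 rec.
case: unb; apply: counts_perm => N N0; symmetry.
rewrite /b shiftp_comp in E.
apply: (facp_counts hn hp t0 _ N0 E).
by rewrite mulf_neq0 ?invr_eq0 ?lead_coef_eq0 // -size_poly_eq0 sab size_poly_eq0.
Qed.

(** * Fatou's lemma *)

Section Fatou.

Variable R : idomainType.
Hypothesis fR : factorial_ring R.
Implicit Types p q g : {poly R}.

Definition eqmodXn N p q : Prop := forall k, (k < N)%N -> p`_k = q`_k.

Lemma eqmodXn_mull N g p q : eqmodXn N p q -> eqmodXn N (g * p) (g * q).
Proof.
move=> h k ltk; rewrite !coefM; apply: eq_bigr => i _.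
by rewrite h // (leq_ltn_trans (leq_subr _ _)).
Qed.

Lemma eqmodXn_cancel N q p g : q`_0 != 0 -> eqmodXn N (q * p) (q * g) ->
  eqmodXn N p g.
Proof.
move=> q0 h; elim/ltn_ind => k IH ltk.
have := h k ltk; rewrite !coefM !big_ord_recl /= !subn0 => /eqP.
rewrite [X in _ + X](eq_bigr (fun i : 'I_k => q`_(bump 0 i) * g`_(k - bump 0 i))).
  by rewrite (inj_eq (addIr _)) (inj_eq (mulfI q0)) => /eqP.
by move=> i _; have lti := ltn_ord i; rewrite IH // /bump /=; lia.
Qed.

(** Fatou: modulo a prime [pi] of [r], the relation [q1 * G = r] forces [G] to
    vanish unless [q1] does, and in the latter case [p1] vanishes too; either
    way a factor [pi] is removed, until [r], and with it the constant term of
    [q1], becomes a unit. *)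
Lemma fatou_bezout p q (r : R) : q`_0 != 0 ->
  (forall N, exists H, eqmodXn N (q * H) p) -> r != 0 ->
  forall p1 q1, q1 != 0 -> q1 * p = p1 * q ->
  (forall N, exists G, eqmodXn N (q1 * G) r%:P) ->
  exists p2 q2, q2`_0 \is a GRing.unit /\ q2 * p = p2 * q.
Proof.
move=> q0 hH r0; have [u [s [hu hs er]]] := fR r0; move: er {r0}.
elim: s hs r => [|pi s IH] hs r er p1 q1 q10 e1 hG.
  have [G hG1] := hG 1%N; have := hG1 0%N isT.
  rewrite coefC eqxx coef0M er big_nil mulr1 => e.
  by exists p1, q1; split=> //; move: hu; rewrite -e unitrM => /andP[].
have pp : prime_elt pi by apply: hs; rewrite mem_head.
have [pi0 _ _] := pp; have piP0 : pi%:P != 0 by rewrite polyC_eq0.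
have hs' x : x \in s -> prime_elt x by move=> xs; apply: hs; rewrite inE xs orbT.
pose r' := u * \prod_(x <- s) x.
have er' : r = r' * pi by rewrite er big_cons /r'; ring.
have cancel_pi N f g : eqmodXn N (pi *: f) (pi *: g) -> eqmodXn N f g.
  by move=> h k ltk; have := h k ltk; rewrite !coefZ => /(mulfI pi0).
have [[q2 eq2]|nd] := EM (divides pi%:P q1).
  have [p2 ep2] : divides pi%:P p1.
    apply/(dividesP pi0) => k; have [H hH1] := hH k.+1.
    have h1 : eqmodXn k.+1 (q1 * H) p1.
      apply: (eqmodXn_cancel q0); rewrite mulrCA -[q * p1]mulrC -e1.
      exact: eqmodXn_mull.
    rewrite -(h1 k (ltnSn k)) eq2 -mulrA mulrCA mulrC coefMC.
    by exists (q2 * H)`_k.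
  apply: (IH hs' r' erefl p2 q2).
  - by apply: contraNneq q10 => z; rewrite eq2 z mul0r.
  - by apply: (mulfI piP0); rewrite !mulrA -[pi%:P * q2]mulrC -[pi%:P * p2]mulrC -eq2 -ep2.
  move=> N; have [G hG1] := hG N; exists G; apply: cancel_pi.
  have -> : pi *: (q2 * G) = q1 * G by rewrite eq2 -mul_polyC; ring.
  by have -> : pi *: r'%:P = r%:P by rewrite -mul_polyC -polyCM mulrC -er'.
apply: (IH hs' r' erefl p1 q1 q10 e1) => N.
have [i ni li] := min_not_dvd pi0 nd.
have [G hG1] := hG (i + N)%N.
have dG k : exists x, (k < N)%N -> G`_k = x * pi.
  have [ltk|] := boolP (k < N)%N; last by exists 0.
  suff [x ex] : divides pi G`_k by exists x.
  apply: (dvd_coefM pp ni li _ (leqnn k)) => j lej; rewrite hG1; last by lia.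
  by rewrite coefC er'; case: ifP => _; [exists r'|apply: divides0].
have [x hx] := choice dG.
exists (\poly_(k < N) x k); apply: cancel_pi.
have -> : pi *: r'%:P = r%:P by rewrite -mul_polyC -polyCM mulrC -er'.
move=> k ltk; rewrite -hG1; last by lia.
rewrite scalerAr; move: k ltk; apply: eqmodXn_mull => k ltk.
by rewrite coefZ coef_poly ltk hx // mulrC.
Qed.

(** A Bezout relation between the coprime parts of [p] and [q] over the
    fraction field provides, after clearing denominators, the constant [r]. *)
Lemma fatou p q : q`_0 != 0 ->
  (forall N, exists H, eqmodXn N (q * H) p) ->
  exists p2 q2, q2`_0 \is a GRing.unit /\ q2 * p = p2 * q.
Proof.
move=> q0 hH.
have qn0 : q != 0 by apply: contraNneq q0 => ->; rewrite coef0.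
pose d := gcdp p q.
have d0 : d != 0 by rewrite gcdp_eq0 negb_and qn0 orbT.
have /Pdiv.WeakIdomain.dvdpP[[c1 p1] /= c10 e1] : d %| p by exact: dvdp_gcdl.
have /Pdiv.WeakIdomain.dvdpP[[c2 q1] /= c20 e2] : d %| q by exact: dvdp_gcdr.
have [[u v] /= /eqpP[[c c'] /= /andP[c0 c'0] e]] := Bezoutp p q.
pose p2 := c2 *: p1; pose q2 := c1 *: q1.
have eF : q2 * p = p2 * q.
  by rewrite /q2 /p2 -!scalerAl ![_ *: (_ * _)]scalerAr e1 e2; ring.
have eB : (c *: u) * p2 + (c *: v) * q2 = (c' * c1 * c2)%:P.
  apply: (mulIf d0); rewrite mulrDl -(mulrA (c *: u)) -(mulrA (c *: v)).
  have -> : p2 * d = (c1 * c2) *: p.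
    by rewrite /p2 -scalerAl -e1 scalerA mulrC.
  have -> : q2 * d = (c1 * c2) *: q.
    by rewrite /q2 -scalerAl -e2 scalerA.
  have -> : (c' * c1 * c2)%:P * d = (c1 * c2) *: (c' *: d).
    by rewrite mul_polyC scalerA; congr (_ *: _); ring.
  rewrite -e -!mul_polyC polyCM; ring.
apply: (@fatou_bezout p q (c' * c1 * c2) q0 hH _ p2 q2 _ eF).
- by rewrite !mulf_neq0.
- rewrite /q2 -mul_polyC mulf_eq0 polyC_eq0 negb_or c10.
  apply: contraNneq qn0 => z; move/eqP: e2.
  by rewrite z mul0r -mul_polyC mulf_eq0 polyC_eq0 (negPf c20).
move=> N; have [H hH1] := hH N; exists ((c *: u) * H + c *: v).
have h2 : eqmodXn N (q2 * H) p2.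
  apply: (eqmodXn_cancel q0); rewrite mulrCA -[q * p2]mulrC -eF.
  exact: eqmodXn_mull.
move=> k ltk; rewrite -eB.
have -> : q2 * ((c *: u) * H + c *: v) = (c *: u) * (q2 * H) + (c *: v) * q2.
  by ring.
by rewrite !coefD (eqmodXn_mull _ h2 ltk).
Qed.

End Fatou.

(** * Polynomials in two variables and their truncations *)

Section Bivariate.

Variable K : numFieldType.
Implicit Types (f g h : {poly {poly K}}) (phi psi : nat -> nat -> K).

Lemma bipolyP f g : (forall k m, f`_k`_m = g`_k`_m) -> f = g.
Proof. by move=> h; apply/polyP => k; apply/polyP => m. Qed.

Definition zmon m k : {poly {poly K}} := ('X^m)%:P * 'X^k.

Lemma coef_zmon m k k' m' : (zmon m k)`_k'`_m' = ((m' == m) && (k' == k))%:R.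
Proof.
by rewrite /zmon coefCM coefXn mulr_natr coefMn coefXn -mulrnA mulnb.
Qed.

Lemma zmonM m k m' k' : zmon m k * zmon m' k' = zmon (m + m') (k + k').
Proof. by rewrite /zmon mulrACA -polyCM -!exprD. Qed.

Lemma zmonX m k i : zmon m k ^+ i = zmon (m * i) (k * i).
Proof. by rewrite /zmon exprMn -rmorphXn /= -!exprM. Qed.

Lemma zmon_neq0 m k : zmon m k != 0.
Proof. by rewrite mulf_neq0 ?polyC_eq0 ?expf_neq0 // polyX_eq0. Qed.

(** Differential operators in [z1 d/dz1] and [z2 d/dz2], given by their
    eigenvalues on the monomials. *)
Definition diagop phi f : {poly {poly K}} :=
  \poly_(k < size f) \poly_(m < size f`_k) (phi m k * f`_k`_m).

Lemma coef_diagop phi f k m : (diagop phi f)`_k`_m = phi m k * f`_k`_m.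
Proof.
rewrite coef_poly; case: ltnP => [_|le]; last first.
  by rewrite [f`_k]nth_default // !coef0 mulr0.
rewrite coef_poly; case: ltnP => // le.
by rewrite [_`_m]nth_default // mulr0.
Qed.

Lemma diagop_add phi f g : diagop phi (f + g) = diagop phi f + diagop phi g.
Proof. by apply: bipolyP => k m; rewrite !coefD !coef_diagop !coefD mulrDr. Qed.

Lemma diagopZ phi (c : K) f : diagop phi (c%:P%:P * f) = c%:P%:P * diagop phi f.
Proof. by apply: bipolyP => k m; rewrite !(coefCM, coef_diagop) mulrCA. Qed.

Lemma diagop_zmon phi m k : diagop phi (zmon m k) = (phi m k)%:P%:P * zmon m k.
Proof.
apply: bipolyP => k' m'; rewrite coef_diagop coef_zmon.
rewrite [in RHS]coefCM [in RHS]coefCM coef_zmon.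
by case: andP => [[/eqP -> /eqP ->]|_]; rewrite ?mulr0.
Qed.

(** The derivation [x z1 d/dz1 + y z2 d/dz2]. *)
Definition nabla (x y : int) : {poly {poly K}} -> {poly {poly K}} :=
  diagop (fun m k => (x * m%:Z + y * k%:Z)%:~R).

Lemma nablaM x y f g : nabla x y (f * g) = nabla x y f * g + f * nabla x y g.
Proof.
apply: bipolyP => k m; rewrite coef_diagop !coefD !coefM !coef_sum.
rewrite mulr_sumr -big_split /=; apply: eq_bigr => i _.
rewrite !coefM mulr_sumr -big_split /=; apply: eq_bigr => j _.
rewrite !coef_diagop; have := ltn_ord i; have := ltn_ord j.
rewrite !ltnS => lej lei.
have -> : (x * m%:Z + y * k%:Z)%:~R = (x * j%:Z + y * i%:Z)%:~R
    + (x * (m - j)%N%:Z + y * (k - i)%N%:Z)%:~R :> K.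
  by rewrite -rmorphD /= -!subzn //; congr (_%:~R); ring.
by ring.
Qed.

Lemma nabla_zmon x y m k :
  nabla x y (zmon m k) = (x * m%:Z + y * k%:Z)%:~R%:P%:P * zmon m k.
Proof. exact: diagop_zmon. Qed.

Lemma nablaX x y f i : nabla x y (f ^+ i.+1) = i.+1%:R * f ^+ i * nabla x y f.
Proof.
elim: i => [|i IH]; first by rewrite expr1 expr0 !mul1r.
by rewrite exprS nablaM IH -[i.+2%:R]natr1 !exprS; ring.
Qed.

(** Congruence modulo the ideal generated by [z2 ^ N] and [z1 ^ M], which
    every diagonal operator preserves. *)
Definition eqcorner N M f g : Prop :=
  forall k m, (k < N)%N -> (m < M)%N -> f`_k`_m = g`_k`_m.

Section Corner.
Variables N M : nat.
Local Notation "f ~ g" := (eqcorner N M f g) (at level 70).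

Lemma eqcorner_sub f g : f ~ g <-> f - g ~ 0.
Proof.
split=> h k m lk lm; have := h k m lk lm; rewrite !coefB !coef0.
  by move=> ->; rewrite subrr.
by move/eqP; rewrite subr_eq0 => /eqP.
Qed.

Lemma eqcornerD f g f' g' : f ~ g -> f' ~ g' -> f + f' ~ g + g'.
Proof. by move=> h h' k m lk lm; rewrite !coefD h ?h'. Qed.

Lemma eqcornerM h f g : f ~ g -> h * f ~ h * g.
Proof.
move=> e k m lk lm; rewrite !coefM !coef_sum; apply: eq_bigr => i _.
rewrite !coefM; apply: eq_bigr => j _.
by rewrite e // (leq_ltn_trans (leq_subr _ _)).
Qed.

Lemma eqcorner_diagop phi f g : f ~ g -> diagop phi f ~ diagop phi g.
Proof. by move=> e k m lk lm; rewrite !coef_diagop e. Qed.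

Lemma eqcorner_trans f g h : f ~ g -> g ~ h -> f ~ h.
Proof. by move=> e e' k m lk lm; rewrite e // e'. Qed.

Lemma eqcorner_cancel (q : {poly {poly K}}) f g : q`_0`_0 != 0 -> q * f ~ q * g -> f ~ g.
Proof.
move=> q0 /eqcorner_sub; rewrite -mulrBr => e; apply/eqcorner_sub.
move: (f - g) e => {}f e.
elim/ltn_ind => k IHk; elim/ltn_ind => m IHm lk lm; rewrite !coef0.
have := e k m lk lm; rewrite !coef0 coefM big_ord_recl /= coefD subn0 coef_sum.
rewrite [X in _ + X]big1 => [|i _]; last first.
  rewrite coefM big1 // => j _; rewrite IHk ?coef0 ?mulr0 //.
  - by have := ltn_ord i; rewrite /bump /=; lia.
  - by apply: leq_ltn_trans lk; rewrite leq_subr.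
  - by apply: leq_ltn_trans lm; rewrite leq_subr.
rewrite addr0 coefM big_ord_recl /= subn0 big1 => [|j _]; last first.
  rewrite IHm ?coef0 ?mulr0 //.
  - by have := ltn_ord j; rewrite /bump /=; lia.
  - by apply: leq_ltn_trans lm; rewrite leq_subr.
by rewrite addr0 => /eqP; rewrite mulf_eq0 (negPf q0) => /eqP.
Qed.

End Corner.

End Bivariate.

(** * Restriction of homogeneous fractions to a two-dimensional torus *)

Section Dehomogenization.

Variables (K : numFieldType) (n : nat).
Variables (cc bb : 'I_n -> int) (C1 C2 : 'I_n -> nat).
Implicit Types (P Q T : mpoly n K) (u v : multinom n) (s : seq 'I_n)
  (ka : 'I_n -> int).

Definition wgt (C : 'I_n -> nat) u : nat := (\sum_(j < n) C j * u j)%N.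

Lemma wgtD C u v : wgt C (mnm_add u v) = (wgt C u + wgt C v)%N.
Proof. by rewrite -big_split /=; apply: eq_bigr => j _; rewrite mnmDE mulnDr. Qed.

Lemma wgt1 C i : wgt C (mnm1 i) = C i.
Proof.
rewrite /wgt (bigD1 i) //= mnm1E eqxx muln1 big1 ?addn0 // => j ne.
by rewrite mnm1E eq_sym (negPf ne) muln0.
Qed.

(** The part of an exponent that is transverse to the two directions [cc] and
    [bb]; it is the degree for the torus action. *)
Definition kappa j u : int :=
  (u j)%:Z - cc j * (wgt C1 u)%:Z - bb j * (wgt C2 u)%:Z.

Lemma kappaD j u v : kappa j (mnm_add u v) = kappa j u + kappa j v.
Proof. by rewrite /kappa mnmDE !wgtD !PoszD; ring. Qed.

Definition homog T ka : Prop := forall u, u \in msupp T -> forall j, kappa j u = ka j.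

Lemma homogM T T' ka ka' : homog T ka -> homog T' ka' ->
  homog (T * T') (fun j => ka j + ka' j).
Proof.
move=> h h' u /msuppM_le /allpairsP[[v v'] /= [hv hv' ->]] j.
by rewrite kappaD h ?h'.
Qed.

Lemma homogD T T' ka : homog T ka -> homog T' ka -> homog (T + T') ka.
Proof.
by move=> h h' u /msuppD_le; rewrite mem_cat => /orP[/h|/h'].
Qed.

Lemma homogZ (c : K) T ka : homog T ka -> homog (c *: T) ka.
Proof. by move=> h u /msuppZ_le /h. Qed.

Lemma homogN T ka : homog T ka -> homog (- T) ka.
Proof. by move=> h; rewrite -scaleN1r; apply: homogZ. Qed.

Lemma homogX u : homog (mpolyX K u) (kappa^~ u).
Proof. by move=> v; rewrite msuppX inE => /eqP ->. Qed.

Lemma homog_eq T ka ka' : ka =1 ka' -> homog T ka -> homog T ka'.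
Proof. by move=> e h u /h hu j; rewrite hu. Qed.

Definition theta j T : mpoly n K := mpolyX K (mnm1 j) * mderiv j T.

Lemma thetaM j T T' : theta j (T * T') = theta j T * T' + T * theta j T'.
Proof. by rewrite /theta mderivM; ring. Qed.

Lemma thetaX j u : theta j (mpolyX K u) = (u j)%:R *: mpolyX K u.
Proof.
rewrite /theta mderivX -scalerAr; have [->|nz] := eqVneq (u j) 0%N.
  by rewrite !scale0r.
rewrite -mpolyXD; congr (_ *: mpolyX _ _); apply/mnmP => i.
rewrite !mnmE; case: eqP => [<-|_]; last by rewrite subn0.
by rewrite addnC subnK // lt0n.
Qed.

Lemma thetaE j T :
  theta j T = \sum_(u <- msupp T) (mcoeff u T * (u j)%:R) *: mpolyX K u.
Proof.
rewrite {1}[T]mpolyE /theta linear_sum mulr_sumr; apply: eq_bigr => u _.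
by rewrite linearZ -scalerAr -/(theta j _) thetaX scalerA.
Qed.

Lemma homog_theta j T ka : homog T ka -> homog (theta j T) ka.
Proof.
move=> h u; rewrite mcoeff_msupp => nz; apply: h; rewrite mcoeff_msupp.
apply: contraNneq nz => z; rewrite thetaE linear_sum big1_seq //= => v _.
rewrite mcoeffZ mcoeffX; case: eqP => [e|]; last by rewrite mulr0.
by rewrite e z !mul0r.
Qed.

(** Restriction to the two-dimensional torus [x_j = z1 ^ C1 j * z2 ^ C2 j]. *)
Definition dehom : mpoly n K -> {poly {poly K}} :=
  mmap (polyC \o polyC) (fun j => zmon K (C1 j) (C2 j)).

HB.instance Definition _ := GRing.RMorphism.on dehom.

Lemma dehomX u : dehom (mpolyX K u) = zmon K (wgt C1 u) (wgt C2 u).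
Proof.
rewrite /dehom mmapX /mmap1 /wgt.
rewrite -[X in _ = X]mul1r; apply: (big_rec3 (fun x y z => x = 1 * zmon K y z)).
  by rewrite /zmon !expr0 mul1r mulr1.
by move=> j x y z _ ->; rewrite zmonX !mul1r zmonM.
Qed.

Lemma dehomC (c : K) : dehom (mpolyC n c) = c%:P%:P.
Proof. exact: mmapC. Qed.

Lemma dehomZ (c : K) T : dehom (c *: T) = c%:P%:P * dehom T.
Proof. by rewrite -mul_mpolyC rmorphM /= dehomC. Qed.

Lemma dehomE T : dehom T =
  \sum_(u <- msupp T) (mcoeff u T)%:P%:P * zmon K (wgt C1 u) (wgt C2 u).
Proof.
rewrite {1}[T]mpolyE rmorph_sum /=; apply: eq_bigr => u _.
by rewrite dehomZ dehomX.
Qed.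

Lemma nabla_sum x y (I : Type) (r : seq I) (F : I -> {poly {poly K}}) :
  nabla x y (\sum_(i <- r) F i) = \sum_(i <- r) nabla x y (F i).
Proof.
elim: r => [|i r IH]; last by rewrite !big_cons /nabla diagop_add -/(nabla x y) IH.
by rewrite !big_nil; apply: bipolyP => k m; rewrite coef_diagop !coef0 mulr0.
Qed.

(** On monomials of degree [ka] the exponent of [x_j] is an affine function of
    the exponents of [z1] and [z2]. *)
Lemma dehom_theta j T ka : homog T ka ->
  dehom (theta j T) = (ka j)%:~R%:P%:P * dehom T + nabla (cc j) (bb j) (dehom T).
Proof.
move=> h; rewrite thetaE rmorph_sum dehomE nabla_sum mulr_sumr -big_split /=.
rewrite big_seq [RHS]big_seq; apply: eq_bigr => u hu.
rewrite dehomZ dehomX /nabla diagopZ -/(nabla _ _ _) nabla_zmon -(h u hu j).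
rewrite (_ : (u j)%:R = (kappa j u)%:~R
    + (cc j * (wgt C1 u)%:Z + bb j * (wgt C2 u)%:Z)%:~R); last first.
  by rewrite -rmorphD /= pmulrn /kappa; congr (_%:~R); ring.
by rewrite mulrDr !polyCD !polyCM; ring.
Qed.

Lemma coef_dehom T ka u : homog T ka -> u \in msupp T ->
  (dehom T)`_(wgt C2 u)`_(wgt C1 u) = mcoeff u T.
Proof.
move=> h hu; rewrite dehomE !coef_sum (bigD1_seq u) ?msupp_uniq //=.
rewrite coefCM coefCM coef_zmon !eqxx mulr1 big1_seq ?addr0 // => v /andP[ne hv].
rewrite coefCM coefCM coef_zmon; case: andP => [[/eqP e1 /eqP e2]|]; rewrite ?mulr0 //.
case/eqP: ne; apply/mnmP => j; have := h u hu j; rewrite -(h v hv j) /kappa e1 e2.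
by move=> /addIr /addIr [].
Qed.

Lemma dehom_eq0 T ka : homog T ka -> dehom T = 0 -> T = 0.
Proof.
move=> h z; apply/mpolyP => u; rewrite mcoeff0.
have [hu|/memN_msupp_eq0 //] := boolP (u \in msupp T).
by rewrite -(coef_dehom h hu) z !coef0.
Qed.

Lemma dehomM T T' : dehom (T * T') = dehom T * dehom T'.
Proof. by rewrite rmorphM. Qed.

(** Monomials of one degree have distinct restrictions to the torus. *)
Lemma dehom_inj T T' ka : homog T ka -> homog T' ka ->
  dehom T = dehom T' -> T = T'.
Proof.
move=> h h' e; apply/eqP; rewrite -subr_eq0; apply/eqP.
apply: (@dehom_eq0 _ ka); last by rewrite rmorphB /= e subrr.
by apply: homogD => //; apply: homogN.
Qed.

(** The numerator of an iterated partial derivative of [P / Q], the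
    denominator being [Q ^+ (size s).+1]. *)
Fixpoint numer P Q s : mpoly n K :=
  if s is j :: s' then
    Q * mderiv j (numer P Q s') - (size s').+1%:R * numer P Q s' * mderiv j Q
  else P.

Definition monl s : mpoly n K := \prod_(j <- s) mpolyX K (mnm1 j).

(** The monomial turns the partial derivatives into operators that preserve
    degrees. *)
Definition tnumer P Q s := monl s * numer P Q s.

Lemma theta_monl j s : theta j (monl s) = (count_mem j s)%:R * monl s.
Proof.
rewrite /monl; elim: s => [|i s IH].
  by rewrite big_nil /theta -[1]/(mpolyC n (1 : K)) mderivC mulr0 mul0r.
rewrite big_cons thetaM IH thetaX mnm1E -mul_mpolyC /= eq_sym natrD.
have -> : mpolyC n ((j == i)%:R : K) = (j == i)%:R.
  by case: (j == i); rewrite ?mpolyC1 ?mpolyC0.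
ring.
Qed.

Lemma tnumer_cons P Q j s : tnumer P Q (j :: s) =
  Q * theta j (tnumer P Q s) - (count_mem j s)%:R * Q * tnumer P Q s
  - (size s).+1%:R * tnumer P Q s * theta j Q.
Proof.
rewrite /tnumer thetaM theta_monl /monl big_cons /= /theta; ring.
Qed.

Lemma homog_tnumer P Q kP kQ s : homog P kP -> homog Q kQ ->
  homog (tnumer P Q s) (fun j => kP j + (size s)%:Z * kQ j).
Proof.
move=> hP hQ; elim: s => [|i s IH].
  rewrite /tnumer /monl big_nil mul1r.
  by apply: homog_eq hP => j; rewrite mul0r addr0.
have e j : kQ j + (kP j + (size s)%:Z * kQ j) = kP j + (size (i :: s))%:Z * kQ j.
  by rewrite /= -addn1 PoszD; ring.
rewrite tnumer_cons; apply: homogD; first apply: homogD.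
- by apply: homog_eq e _; apply: homogM => //; apply: homog_theta.
- apply: homogN; rewrite -mulrA mulr_natl -scaler_nat; apply: homogZ.
  by apply: homog_eq e _; apply: homogM.
- apply: homogN; rewrite -mulrA mulr_natl -scaler_nat; apply: homogZ.
  rewrite mulrC; apply: homog_eq e _; apply: homogM => //; exact: homog_theta.
Qed.

Section Numerators.

Variables (P Q : mpoly n K) (kP kQ : 'I_n -> int).
Variables (q : {poly {poly K}}) (m0 k0 : nat).
Hypotheses (hP : homog P kP) (hQ : homog Q kQ).
Hypothesis eQ : dehom Q = zmon K m0 k0 * q.

(** The exponents of the monomial by which [P / Q] differs from the quotient
    [dehom P / q] of polynomials in [z1] and [z2]. *)
Definition expo j : int := kP j - kQ j - cc j * m0%:Z - bb j * k0%:Z.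

(** The numerators restricted to the torus, relative to the denominator [q]
    deprived of the monomial [zmon m0 k0]. *)
Fixpoint bnumer s : {poly {poly K}} :=
  if s is j :: s' then
    q * nabla (cc j) (bb j) (bnumer s')
    - (size s').+1%:R * bnumer s' * nabla (cc j) (bb j) q
    + (expo j - (count_mem j s')%:Z)%:~R%:P%:P * q * bnumer s'
  else dehom P.

Lemma dehom_tnumer s : dehom (tnumer P Q s) = zmon K m0 k0 ^+ size s * bnumer s.
Proof.
elim: s => [|j s IH] /=.
  by rewrite /tnumer /monl big_nil mul1r expr0 mul1r.
rewrite tnumer_cons.
have := dehom_theta j (homog_tnumer (s := s) hP hQ); move: IH.
move: (tnumer P Q s) (theta j (tnumer P Q s)) => T T' eT eT'.
move: (theta j Q) (dehom_theta j hQ) => Q' eQ'.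
rewrite !rmorphB !rmorphM /= !rmorph_nat eQ' eT' eQ eT.
set z := zmon K m0 k0; set d := cc j * m0%:Z + bb j * k0%:Z.
have nz i f : nabla (cc j) (bb j) (z ^+ i * f) =
    z ^+ i * (nabla (cc j) (bb j) f + (i%:Z * d)%:~R%:P%:P * f).
  rewrite nablaM zmonX nabla_zmon.
  have -> : cc j * (m0 * i)%N%:Z + bb j * (k0 * i)%N%:Z = i%:Z * d.
    by rewrite /d !PoszM; ring.
  ring.
have nz1 := nz 1%N q; rewrite expr1 mul1r in nz1; rewrite nz nz1 exprS.
rewrite /d !(rmorphD, rmorphB, rmorphM, rmorphN) /= !rmorph_nat.
ring.
Qed.

(** The falling factorials by which the derivations of [s] multiply the
    monomial [z1 ^ m * z2 ^ k] of an expansion. *)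
Definition ffac s (m k : nat) : K :=
  (\prod_(j < n) \prod_(i < count_mem j s)
     (expo j + cc j * m%:Z + bb j * k%:Z - i%:Z))%:~R.

Lemma ffac_cons j s m k : ffac (j :: s) m k =
  (expo j + cc j * m%:Z + bb j * k%:Z - (count_mem j s)%:Z)%:~R * ffac s m k.
Proof.
rewrite /ffac -rmorphM /=; congr (_%:~R).
rewrite (bigD1 j) //= [in RHS](bigD1 j) //= eqxx add1n big_ord_recr /=.
rewrite mulrAC mulrC; congr (_ * (_ * _)).
by apply: eq_bigr => i ne; rewrite eq_sym (negPf ne) add0n.
Qed.

(** A truncated expansion [H] of [dehom P / q] follows the recursion of the
    numerators. *)
Lemma ffac_bnumer N M H s : eqcorner N M (q * H) (dehom P) ->
  eqcorner N M (q ^+ (size s).+1 * diagop (ffac s) H) (bnumer s).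
Proof.
move=> hH; elim: s => [|j s IH].
  rewrite expr1 (_ : diagop _ H = H) //; apply: bipolyP => k m.
  rewrite coef_diagop /ffac big1 ?mul1r // => j _; exact: big_ord0.
set G := diagop (ffac s) H in IH.
pose x := expo j - (count_mem j s)%:Z.
have eG : diagop (ffac (j :: s)) H = x%:~R%:P%:P * G + nabla (cc j) (bb j) G.
  apply: bipolyP => k m; rewrite !coefD coefCM coefCM !coef_diagop ffac_cons.
  rewrite -mulrA -mulrDl -rmorphD /=; congr (_%:~R * _); rewrite /x; ring.
have e1 : q ^+ (size s).+2 * diagop (ffac (j :: s)) H =
    q * nabla (cc j) (bb j) (q ^+ (size s).+1 * G)
    - (size s).+1%:R * nabla (cc j) (bb j) q * (q ^+ (size s).+1 * G)
    + x%:~R%:P%:P * q * (q ^+ (size s).+1 * G).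
  by rewrite eG nablaM nablaX !exprS; ring.
have e2 : bnumer (j :: s) = q * nabla (cc j) (bb j) (bnumer s)
    - (size s).+1%:R * nabla (cc j) (bb j) q * bnumer s
    + x%:~R%:P%:P * q * bnumer s by rewrite /= -/x; ring.
rewrite /= in e1 e2 *; rewrite e1 e2.
apply: eqcornerD; last exact: eqcornerM.
rewrite -!mulNr; apply: eqcornerD; last exact: eqcornerM.
by apply: eqcornerM; apply: eqcorner_diagop.
Qed.

End Numerators.

End Dehomogenization.

(** * Expansions along a circuit *)

Section CircuitWords.

Variables (n : nat) (cc : 'I_n -> int).

(** The derivations occurring in one side of the circuit operator. *)
Definition circuit_word (S : pred 'I_n) : seq 'I_n :=
  flatten [seq nseq (if S j then absz (cc j) else 0) j | j <- enum 'I_n].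

Let pos := [pred j | 0 < cc j].
Let neg := [pred j | cc j < 0].

Lemma count_circuit_word S j :
  count_mem j (circuit_word S) = if S j then absz (cc j) else 0%N.
Proof.
rewrite /circuit_word count_flatten -map_comp sumnE big_map big_enum /=.
rewrite (bigD1 j) //= count_nseq /= eqxx mul1n big1 ?addn0 // => i ne.
by rewrite count_nseq /= (negPf ne) mul0n.
Qed.

Lemma size_circuit_word S : size (circuit_word S) = (\sum_(j | S j) absz (cc j))%N.
Proof.
rewrite /circuit_word size_flatten /shape -map_comp sumnE big_map big_enum /=.
by rewrite [RHS]big_mkcond /=; apply: eq_bigr => i _; rewrite size_nseq.
Qed.

Lemma pos_neg j : (if pos j then absz (cc j) else 0%N)%:Z
  - (if neg j then absz (cc j) else 0%N)%:Z = cc j.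
Proof. by rewrite /pos /neg /=; case: (ltrgtP 0 (cc j)); lia. Qed.

Lemma sum_pos_neg (C : 'I_n -> int) :
  \sum_(j | pos j) C j * (absz (cc j))%:Z
  = \sum_(j | neg j) C j * (absz (cc j))%:Z + \sum_j C j * cc j.
Proof.
rewrite big_mkcond /= [X in _ = X + _]big_mkcond /= -big_split /=.
apply: eq_bigr => j _; rewrite -[in C j * cc j]pos_neg.
rewrite /pos /neg /=.
by case: (0 < cc j); case: (cc j < 0); rewrite /= ?subrr ?subr0 ?sub0r; ring.
Qed.

Lemma size_pos_neg : \sum_j cc j = 0 ->
  size (circuit_word pos) = size (circuit_word neg).
Proof.
move=> sum_cc; apply/eqP; rewrite -eqz_nat !size_circuit_word.
have h (S : pred 'I_n) : (\sum_(j | S j) absz (cc j))%N%:Z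
    = \sum_(j | S j) (fun=> 1) j * (absz (cc j))%:Z.
  rewrite (big_morph Posz PoszD (erefl _)); apply: eq_bigr => j _.
  by rewrite mul1r.
rewrite !h sum_pos_neg [X in _ + X](_ : _ = 0) ?addr0 // -[RHS]sum_cc.
by apply: eq_bigr => j _; rewrite mul1r.
Qed.

End CircuitWords.

Section CircuitExpansion.

Variables (K : numFieldType) (n : nat).
Variables (cc bb : 'I_n -> int) (C1 C2 : 'I_n -> nat).
Hypothesis C1cc : \sum_j (C1 j)%:Z * cc j = 1.
Hypothesis C2cc : \sum_j (C2 j)%:Z * cc j = 0.

Local Notation circuit_word := (circuit_word cc).
Let pos := [pred j | 0 < cc j].
Let neg := [pred j | cc j < 0].

Lemma dehom_monl s : dehom C1 C2 (monl K s)
  = zmon K (\sum_j C1 j * count_mem j s)%N (\sum_j C2 j * count_mem j s)%N.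
Proof.
rewrite /monl rmorph_prod /=; elim: s => [|i s IH].
  by rewrite big_nil !big1 /zmon ?expr0 ?mulr1 // => j _; rewrite muln0.
have e (C : 'I_n -> nat) : (\sum_j C j * count_mem j (i :: s) =
    C i + \sum_j C j * count_mem j s)%N.
  rewrite (bigD1 i) //= [in RHS](bigD1 i) //= eqxx mulnDr muln1 addnA.
  by congr addn; apply: eq_bigr => j ne; rewrite eq_sym (negPf ne) add0n.
by rewrite big_cons IH dehomX !wgt1 zmonM !e.
Qed.

Lemma dehom_circuit_word :
  dehom C1 C2 (monl K (circuit_word pos))
  = zmon K 1 0 * dehom C1 C2 (monl K (circuit_word neg)).
Proof.
have e (C : 'I_n -> nat) S : (\sum_j C j * count_mem j (circuit_word S))%N%:Z
    = \sum_(j | S j) (C j)%:Z * (absz (cc j))%:Z.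
  rewrite (big_morph Posz PoszD (erefl _)) [RHS]big_mkcond /=.
  apply: eq_bigr => j _; rewrite count_circuit_word PoszM.
  by case: (S j); rewrite ?mulr0.
rewrite !dehom_monl zmonM; congr (zmon K _ _); apply/eqP; rewrite -eqz_nat.
  by rewrite PoszD !e sum_pos_neg C1cc addrC.
by rewrite add0n !e sum_pos_neg C2cc addr0.
Qed.

Variables (P Q : mpoly n K) (kP kQ : 'I_n -> int).
Variables (q : {poly {poly K}}) (m0 k0 : nat).
Hypotheses (hP : homog cc bb C1 C2 P kP) (hQ : homog cc bb C1 C2 Q kQ).
Hypothesis eQ : dehom C1 C2 Q = zmon K m0 k0 * q.
Hypothesis q00 : q`_0`_0 != 0.
Hypothesis sum_cc : \sum_j cc j = 0.
Hypothesis box : numer P Q (circuit_word pos) = numer P Q (circuit_word neg).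

Let e := expo cc bb kP kQ m0 k0.

Lemma ffac_facp (S : pred 'I_n) m k :
  ffac K cc bb kP kQ m0 k0 (circuit_word S) m k =
  (facp K cc S (fun j => e j + bb j * k%:Z)).[m%:R].
Proof.
rewrite /ffac /facp rmorph_prod horner_prod [RHS]big_mkcond /=.
apply: eq_bigr => j _; rewrite count_circuit_word; case: (S j); last first.
  by rewrite big_ord0.
rewrite rmorph_prod horner_prod /=; apply: eq_bigr => i _.
rewrite linpE [m%:R]pmulrn -rmorphM -rmorphD /=; congr (_%:~R); rewrite -/e; ring.
Qed.

Lemma bnumer_circuit :
  bnumer cc bb C1 C2 P kP kQ q m0 k0 (circuit_word pos)
  = zmon K 1 0 * bnumer cc bb C1 C2 P kP kQ q m0 k0 (circuit_word neg).
Proof.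
have z0 : zmon K m0 k0 ^+ size (circuit_word neg) != 0.
  by rewrite expf_neq0 // zmon_neq0.
apply: (mulfI z0); rewrite [RHS]mulrCA -(dehom_tnumer hP hQ eQ) -{1}(size_pos_neg sum_cc).
rewrite -(dehom_tnumer hP hQ eQ) /tnumer !rmorphM /= dehom_circuit_word box.
by rewrite mulrA.
Qed.

(** The two sides of the circuit equation have the same numerator, up to the
    factor [z1]. A power of [q] is cancelled and the coefficients of the
    expansion are compared, those of different powers of [z2] staying apart.
    *)
Lemma circuit_recurrence N M H : eqcorner N M (q * H) (dehom C1 C2 P) ->
  forall k m, (k < N)%N -> (m.+1 < M)%N ->
  (facp K cc pos (fun j => e j + bb j * k%:Z)).[m.+1%:R] * H`_k`_m.+1
  = (facp K cc neg (fun j => e j + bb j * k%:Z)).[m%:R] * H`_k`_m.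
Proof.
move=> hH k m ltk ltm.
have h1 := ffac_bnumer cc bb kP kQ m0 k0 (circuit_word pos) hH.
have h2 := ffac_bnumer cc bb kP kQ m0 k0 (circuit_word neg) hH.
rewrite (size_pos_neg sum_cc) in h1.
set Q' := q ^+ _ in h1 h2.
have h3 : eqcorner N M
    (Q' * diagop (ffac K cc bb kP kQ m0 k0 (circuit_word pos)) H)
    (Q' * (zmon K 1 0 * diagop (ffac K cc bb kP kQ m0 k0 (circuit_word neg)) H)).
  rewrite mulrCA; apply: (eqcorner_trans h1); rewrite bnumer_circuit.
  by move=> k' m' lk lm; rewrite (eqcornerM _ h2).
have Q'0 : Q'`_0`_0 != 0.
  have c0 (f : {poly {poly K}}) : f`_0`_0 = f.[0].[0] by rewrite !horner_coef0.
  by rewrite c0 /Q' !horner_exp -c0 expf_neq0.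
have := eqcorner_cancel Q'0 h3 ltk ltm.
rewrite coef_diagop ffac_facp => ->.
rewrite /zmon expr0 mulr1 coefCM coefXM /= coef_diagop ffac_facp.
by [].
Qed.

End CircuitExpansion.

Lemma series_quotient (K : fieldType) (q r : {poly K}) : q`_0 != 0 ->
  exists c : nat -> K, forall M, eqmodXn M (q * \poly_(i < M) c i) r.
Proof.
move=> q0; have ex M : exists f, eqmodXn M (q * f) r.
  elim: M => [|M [f hf]]; first by exists 0.
  pose a := (r - q * f)`_M / q`_0.
  exists (f + a%:P * 'X^M) => k; rewrite ltnS leq_eqVlt.
  rewrite mulrDr mulrA coefD coefMXn coefMC.
  case/predU1P => [->|ltk]; last by rewrite ltk addr0 hf.
  by rewrite ltnn subnn [q`_0 * a]mulrC divfK // coefB addrCA subrr addr0.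
have [f hf] := choice ex.
exists (fun m => (f m.+1)`_m) => M k ltk; rewrite -(hf M k ltk).
move: k ltk; apply: eqmodXn_mull => k ltk; rewrite coef_poly ltk.
apply: (eqmodXn_cancel (N := k.+1) q0 _ (ltnSn k)) => j ltj.
have lk : (j < M)%N by apply: leq_ltn_trans ltk.
by rewrite (hf _ j ltj) (hf _ j lk).
Qed.

Section CircuitPolynomial.

Variables (K : numFieldType) (n : nat).
Variables (cc bb : 'I_n -> int) (C1 C2 : 'I_n -> nat).
Hypothesis C1cc : \sum_j (C1 j)%:Z * cc j = 1.
Hypothesis C2cc : \sum_j (C2 j)%:Z * cc j = 0.
Variables (P Q : mpoly n K) (kP kQ : 'I_n -> int).
Variables (q : {poly {poly K}}) (m0 k0 : nat).
Hypotheses (hP : homog cc bb C1 C2 P kP) (hQ : homog cc bb C1 C2 Q kQ).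
Hypothesis eQ : dehom C1 C2 Q = zmon K m0 k0 * q.
Hypothesis q00 : q`_0`_0 != 0.
Hypothesis sum_cc : \sum_j cc j = 0.
Hypothesis box : numer P Q (circuit_word cc [pred j | 0 < cc j])
  = numer P Q (circuit_word cc [pred j | cc j < 0]).
Hypothesis unbalanced :
  ~ perm_eq [seq cc j | j <- enum 'I_n] [seq - cc j | j <- enum 'I_n].

(** Induction on the power of [z2]: given the earlier coefficients, the next
    one is a rational function of [z1] whose power series obeys the circuit
    recurrence, hence a polynomial as the situation is unbalanced. *)
Lemma circuit_expansion N : exists H, eqmodXn N (q * H) (dehom C1 C2 P).
Proof.
suff [H [_ hH]] : exists H : {poly {poly K}},
    (size H <= N)%N /\ eqmodXn N (q * H) (dehom C1 C2 P).
  by exists H.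
elim: N => [|N [H [szH hH]]]; first by exists 0; rewrite size_poly0.
set p := dehom C1 C2 P in hH *; pose r := (p - q * H)`_N.
have [c hc] := series_quotient r q00.
pose H' M := H + (\poly_(i < M) c i)%:P * 'X^N.
have qH' M : q * H' M = q * H + (q * (\poly_(i < M) c i)%:P) * 'X^N.
  by rewrite mulrDr mulrA.
have H'N M : (H' M)`_N = \poly_(i < M) c i.
  by rewrite coefD nth_default // add0r coefMXn ltnn subnn coefC.
have corner M : eqcorner N.+1 M (q * H' M) p.
  move=> k m; rewrite ltnS leq_eqVlt qH' coefD coefMXn => /predU1P[->|ltk] ltm.
    rewrite ltnn subnn coefMC coefD (hc M m ltm) /r coefB coefB.
    by rewrite addrCA subrr addr0.
  by rewrite ltk addr0 hH.
have [h eh] : exists h, r = q`_0 * h.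
  apply: (unbalanced_series_divides (c := c)
    (e := fun j => expo cc bb kP kQ m0 k0 j + bb j * N%:Z) sum_cc unbalanced q00).
    move=> m; rewrite -(hc m.+1 m (ltnSn m)) coefM; apply: eq_bigr => i _.
    by rewrite coef_poly ltnS leq_subr.
  move=> m; have := circuit_recurrence C1cc C2cc hP hQ eQ q00 sum_cc box
    (corner m.+2) (ltnSn N) (ltnSn m.+1).
  by rewrite H'N !coef_poly ltnSn ltnS leqnSn.
exists (H + h%:P * 'X^N); split.
  apply: leq_trans (size_polyD _ _) _; rewrite geq_max (leq_trans szH) //=.
  apply: leq_trans (size_polyMleq _ _) _.
  by rewrite size_polyXn size_polyC; case: eqP => //=; lia.
move=> k; rewrite ltnS leq_eqVlt mulrDr mulrA coefD coefMXn.
case/predU1P => [->|ltk]; last by rewrite ltk addr0 hH.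
by rewrite ltnn subnn coefMC -eh /r coefB addrCA subrr addr0.
Qed.

Lemma circuit_fatou : exists p2 q2 : {poly {poly K}},
  q2`_0 \is a GRing.unit /\ q2 * dehom C1 C2 P = p2 * q.
Proof.
apply: fatou circuit_expansion.
  by apply: factorial_poly; apply: field_factorial.
by apply: contraNneq q00 => ->; rewrite coef0.
Qed.

End CircuitPolynomial.

(** * Eigenfunctions of the Euler operators *)

Section HomogeneousReduction.

Variables (K : numFieldType) (d n : nat) (A : 'M[int]_(d, n)).
Implicit Types (P Q T a b : mpoly n K) (u : multinom n).

Definition degA i u : int := \sum_(j < n) A i j * (u j)%:Z.

Definition euler i T : mpoly n K := \sum_(j < n) (A i j)%:~R *: theta j T.

Lemma coef_theta j T u : mcoeff u (theta j T) = (u j)%:R * mcoeff u T.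
Proof.
rewrite thetaE linear_sum /=.
rewrite (eq_bigr (fun v => (u j)%:R * (mcoeff v T * (v == u)%:R))) => [|v _].
  rewrite -mulr_sumr; congr (_ * _); rewrite [in RHS](mpolyE T) linear_sum /=.
  by apply: eq_bigr => v _; rewrite mcoeffZ mcoeffX.
rewrite mcoeffZ mcoeffX; case: eqP => [->|_]; last by rewrite !mulr0.
by rewrite !mulr1 mulrC.
Qed.

Lemma coef_euler i T u : mcoeff u (euler i T) = (degA i u)%:~R * mcoeff u T.
Proof.
rewrite /euler linear_sum /degA rmorph_sum mulr_suml; apply: eq_bigr => j _.
by rewrite /= mcoeffZ coef_theta mulrA pmulrn -rmorphM.
Qed.

Lemma eulerM i T T' : euler i (T * T') = euler i T * T' + T * euler i T'.
Proof.
rewrite /euler mulr_suml mulr_sumr -big_split /=; apply: eq_bigr => j _.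
by rewrite thetaM scalerDr -scalerAl -scalerAr.
Qed.

(** The relation [Q * a = P * b] is preserved by the shifted Euler operators.
    Take [b] with the fewest monomials: it is homogeneous, as otherwise one of
    these operators would remove a monomial from it. *)
Lemma homogeneous_fraction P Q (alpha : 'cV[int]_d) : Q != 0 -> P != 0 ->
  (forall i, euler i P * Q - P * euler i Q = (alpha i 0)%:~R *: (P * Q)) ->
  exists a b (ga : 'I_d -> int),
    [/\ Q * a = P * b, b != 0, a != 0,
      forall u, u \in msupp b -> forall i, degA i u = ga i &
      forall u, u \in msupp a -> forall i, degA i u = ga i + alpha i 0].
Proof.
move=> Q0 P0 hE.
have step a b i (de : int) : Q * a = P * b ->
    Q * (euler i a - (alpha i 0 + de)%:~R *: a)
    = P * (euler i b - de%:~R *: b).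
  move=> e; apply: (mulfI Q0).
  have := congr1 (fun T => Q * euler i T) e; rewrite /= !eulerM => e1.
  have e2 := hE i; move: e2 => /(congr1 (fun T => T * b)); rewrite /= => e2.
  have e3 : (alpha i 0 + de)%:~R *: a = (alpha i 0)%:~R *: a + de%:~R *: a.
    by rewrite rmorphD scalerDl.
  rewrite {}e3; rewrite -!mul_mpolyC in e2 *.
  move: e1 e2; set x := mpolyC _ (alpha i 0)%:~R; set y := mpolyC _ de%:~R.
  move: (euler i a) (euler i b) (euler i P) (euler i Q) => Ea Eb EP EQ e1 e2.
  have -> : Q * (Q * (Ea - (x * a + y * a)))
     = Q * (EQ * a + Q * Ea) - EQ * (Q * a) - (x + y) * Q * (Q * a) by ring.
  rewrite e1 e; apply/eqP; rewrite -subr_eq0.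
  have -> : Q * (EP * b + P * Eb) - EQ * (P * b) - (x + y) * Q * (P * b)
      - Q * (P * (Eb - y * b)) = (EP * Q - P * EQ) * b - x * (P * Q) * b by ring.
  by rewrite e2 subrr.
have [k lek] : exists k, exists a b, [/\ Q * a = P * b, b != 0
    & (size (msupp b) < k)%N].
  by exists (size (msupp Q)).+1, P, Q; rewrite mulrC.
elim: k lek => [|k IH] [a [b [e b0 lek]]] //.
have [[u [v [i [hu hv ne]]]]|hom] := EM (exists u v i,
    [/\ u \in msupp b, v \in msupp b & degA i u <> degA i v]).
  apply: IH; exists (euler i a - (alpha i 0 + degA i u)%:~R *: a).
  exists (euler i b - (degA i u)%:~R *: b).
  have cE w : mcoeff w (euler i b - (degA i u)%:~R *: b)
      = (degA i w - degA i u)%:~R * mcoeff w b.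
    by rewrite mcoeffB mcoeffZ coef_euler rmorphB mulrBl.
  split; first exact: step.
    apply/eqP => /(congr1 (mcoeff v)); rewrite cE mcoeff0 => /eqP.
    rewrite mulf_eq0 intr_eq0 subr_eq0 mcoeff_eq0 hv orbF => /eqP z.
    by apply: ne.
  rewrite -ltnS; apply: leq_trans lek; rewrite ltnS.
  have : {subset u :: msupp (euler i b - (degA i u)%:~R *: b) <= msupp b}.
    move=> w; rewrite inE => /predU1P[->//|]; rewrite !mcoeff_msupp cE.
    by apply: contraNneq => ->; rewrite mulr0.
  move=> /uniq_leq_size; apply; rewrite /= msupp_uniq andbT mcoeff_msupp cE.
  by rewrite subrr mul0r eqxx.
have u0 := mlead_supp b0.
exists a, b, (fun i => degA i (mlead b)).
have hb u : u \in msupp b -> forall i, degA i u = degA i (mlead b).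
  move=> hu i; apply: contrapT => ne; apply: hom.
  by exists u, (mlead b), i.
split=> //.
  apply: contraNneq b0 => z; move/eqP: e; rewrite z mulr0 eq_sym mulf_eq0.
  by rewrite (negPf P0).
move=> u hu i; apply/eqP; rewrite -subr_eq0 -(intr_eq0 K).
have := step a b i (degA i (mlead b)) e.
have -> : euler i b - (degA i (mlead b))%:~R *: b = 0.
  apply/mpolyP => w; rewrite mcoeffB mcoeffZ coef_euler mcoeff0.
  have [hw|/memN_msupp_eq0 ->] := boolP (w \in msupp b).
    by rewrite hb // subrr.
  by rewrite !mulr0 subrr.
rewrite mulr0 => /eqP; rewrite mulf_eq0 (negPf Q0) /= => /eqP.
move=> /(congr1 (mcoeff u)); rewrite mcoeffB mcoeffZ coef_euler mcoeff0 -mulrBl.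
move/eqP; rewrite mulf_eq0 (mcoeff_eq0 a) hu orbF -rmorphB /=.
by rewrite [alpha i 0 + _]addrC.
Qed.

End HomogeneousReduction.

(** * Partial derivatives of polynomials and rational functions *)

Import numFieldNormedType.Exports.
Local Open Scope classical_set_scope.
Local Open Scope ring_scope.

Local Notation eval := Defs.eval.

Section PolynomialCalculus.

Variables (K : numFieldType) (n : nat).
Implicit Types (p P Q a b : mpoly n K) (x y : 'rV[K]_n) (V : set 'rV[K]_n).

Lemma evalM p P x : eval (p * P) x = eval p x * eval P x.
Proof. exact: mevalM. Qed.

Lemma is_derive_coord x (v : 'rV[K]_n) i :
  is_derive x v (fun y => y 0 i : K^o) (v 0 i).
Proof.
have h : \forall e \near (0 : K)^',
    e^-1 *: (((fun y => y 0 i : K^o) \o shift x) (e *: v) - x 0 i) = v 0 i.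
  near=> e; rewrite /= !mxE addrK scalerA mulVf ?scale1r //.
  by near: e; exact: nbhs_dnbhs_neq.
apply: DeriveDef; first exact: (is_cvg_near_cst (v 0 i)).
by apply: lim_near_cst => //; exact: norm_hausdorff.
Unshelve. all: by end_near. Qed.

Definition smooth_poly p : Prop := forall x,
  {for x, continuous (fun y => eval p y : K^o)} /\
  forall j, is_derive x (delta_mx 0 j) (fun y => eval p y : K^o)
    (eval (mderiv j p) x).

Lemma smoothD p P : smooth_poly p -> smooth_poly P -> smooth_poly (p + P).
Proof.
move=> hp hP x; have [cp dp] := hp x; have [cP dP] := hP x.
have e : (fun y => eval (p + P) y : K^o)
    = (fun y => eval p y : K^o) + (fun y => eval P y : K^o).
  by apply/funext => y; rewrite /eval mevalD.
rewrite e; split=> [|j]; first exact: continuousD.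
by rewrite mderivD /eval mevalD; apply: is_deriveD.
Qed.

Lemma smoothM p P : smooth_poly p -> smooth_poly P -> smooth_poly (p * P).
Proof.
move=> hp hP x; have [cp dp] := hp x; have [cP dP] := hP x.
have e : (fun y => eval (p * P) y : K^o)
    = (fun y => eval p y : K^o) * (fun y => eval P y : K^o).
  by apply/funext => y; rewrite /eval mevalM.
rewrite e; split=> [|j]; first exact: continuousM.
rewrite mderivM /eval mevalD !mevalM addrC [X in _ + X]mulrC.
exact: is_deriveM.
Qed.

Lemma smoothC (c : K) : smooth_poly (mpolyC n c).
Proof.
move=> x; have e : (fun y => eval (mpolyC n c) y : K^o) = cst c.
  by apply/funext => y; rewrite /eval mevalC.
rewrite e; split=> [|j]; first exact: cst_continuous.
by rewrite mderivC /eval meval0; apply: is_derive_cst.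
Qed.

Lemma smoothX i : smooth_poly (mpolyX K (mnm1 i)).
Proof.
move=> x; have e : (fun y => eval (mpolyX K (mnm1 i)) y : K^o) = (fun y => y 0 i).
  by apply/funext => y; rewrite /eval mevalXU.
rewrite e; split=> [|j]; first exact: coord_continuous.
have -> : eval (mderiv j (mpolyX K (mnm1 i))) x = (delta_mx 0 j : 'rV[K]_n) 0 i.
  rewrite mderivX mnm1E mxE /= eq_sym /eval mevalZ; case: eqP => [->|_].
    by rewrite mul1r mevalX big1 // => l _; rewrite mnmBE subnn expr0.
  by rewrite mul0r.
exact: is_derive_coord.
Qed.

Lemma smooth_polyP p : smooth_poly p.
Proof.
rewrite [p]mpolyE; apply: (big_ind smooth_poly).
- by rewrite -(mpolyC0 n K); exact: smoothC.
- exact: smoothD.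
move=> m _; rewrite -mul_mpolyC; apply: smoothM; first exact: smoothC.
rewrite mpolyXE_id; apply: (big_ind smooth_poly).
- by rewrite -(mpolyC1 n K); exact: smoothC.
- exact: smoothM.
move=> i _; elim: (m i) => [|k IH].
  by rewrite expr0 -(mpolyC1 n K); exact: smoothC.
by rewrite exprS; apply: smoothM => //; exact: smoothX.
Qed.

Lemma open_eval_neq0 p : open [set x | eval p x != 0].
Proof.
have o : open [set z : K^o | z != 0].
  have -> : [set z : K^o | z != 0] = ~` [set 0].
    by apply/seteqP; split=> z /= => [/eqP|/eqP].
  apply: closed_openC; apply: accessible_closed_set1.
  by apply: hausdorff_accessible; exact: norm_hausdorff.
apply: (open_comp (f := fun x => eval p x : K^o) _ o) => x _.
by have [] := smooth_polyP p x.
Qed.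

Lemma partial_near j (f g : 'rV[K]_n -> K^o) V x : open V -> V x ->
  (forall y, V y -> f y = g y) -> partial j f x = partial j g x.
Proof.
move=> oV Vx fg; rewrite /partial; apply: near_eq_derive.
have : nbhs x V by apply: open_nbhs_nbhs.
by apply: filterS => y /fg.
Qed.

Lemma partial_fraction j P Q k (f : 'rV[K]_n -> K^o) V : open V ->
  (forall y, V y -> eval Q y != 0) ->
  (forall y, V y -> f y = eval P y / eval Q y ^+ k) ->
  forall x, V x -> partial j f x =
    eval (Q * mderiv j P - k%:R * P * mderiv j Q) x / eval Q x ^+ k.+1.
Proof.
move=> oV Q0 hf x Vx.
have [_ /(_ j) dP] := smooth_polyP P x.
have [_ /(_ j) dQ] := smooth_polyP (Q ^+ k) x.
have Qx : eval Q x != 0 by exact: Q0.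
have Qk : eval (Q ^+ k) x != 0 by rewrite /eval rmorphXn expf_neq0.
rewrite (partial_near j (g := (fun y => eval P y : K^o) *
   (fun y => (eval (Q ^+ k) y)^-1 : K^o)) oV Vx); last first.
  by move=> y Vy; rewrite hf // -[RHS]/(eval P y * (eval (Q ^+ k) y)^-1) /eval rmorphXn.
have dVd := derivableV Qk (ex_derive (is_derive := dQ)).
have dVv := deriveV Qk (ex_derive (is_derive := dQ)).
rewrite /partial deriveM //.
rewrite dVv (derive_val (is_derive := dP)) (derive_val (is_derive := dQ)).
have -> : mderiv j (Q ^+ k) = k%:R * Q ^+ k.-1 * mderiv j Q.
  elim: (k) => [|[|i] IH]; first by rewrite expr0 -(mpolyC1 n K) mderivC !mul0r.
    by rewrite expr1 expr0 !mul1r.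
  by rewrite exprS mderivM IH /= -[i.+2%:R]natr1 [Q ^+ i.+1]exprS; ring.
rewrite /GRing.scale /= /eval !rmorphB !rmorphM /= !rmorphXn !rmorph_nat /=.
rewrite -/(eval Q x) in Qx *; set q := eval Q x in Qx *.
case: k {hf dQ Qk dVd dVv} => [|k]; first by rewrite !expr0 /=; field.
by rewrite /= !exprS; field; rewrite Qx expf_neq0.
Qed.

Lemma partials_word P Q s (f : 'rV[K]_n -> K^o) V : open V ->
  (forall y, V y -> eval Q y != 0) ->
  (forall y, V y -> f y = eval P y / eval Q y) ->
  forall x, V x -> foldr (@partial K n) f s x =
    eval (numer P Q s) x / eval Q x ^+ (size s).+1.
Proof.
move=> oV Q0 hf; elim: s => [|j s IH] x Vx; first by rewrite /= hf // expr1.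
rewrite /= (partial_fraction j oV Q0 IH Vx).
by [].
Qed.

Definition deriv_word (u : 'cV[nat]_n) : seq 'I_n :=
  flatten [seq nseq (u j 0) j | j <- enum 'I_n].

Lemma partials_deriv_word u (f : 'rV[K]_n -> K^o) :
  partials u f = foldr (@partial K n) f (deriv_word u).
Proof.
rewrite /partials /deriv_word; elim: (enum 'I_n) => //= j s IH.
rewrite IH foldr_cat; elim: (u j 0) => //= k ->.
by [].
Qed.

(** The derivatives of a polynomial vanishing on an open set vanish there too,
    so its coefficients are zero by induction on the degree. *)
Lemma eval_open_eq0 p V : open V -> V !=set0 ->
  (forall x, V x -> eval p x = 0) -> p = 0.
Proof.
move=> oV [x0 Vx0].
have [k lek] : exists k, forall u, u \in msupp p -> (mdeg u < k)%N.
  by exists (msize p) => u; apply: msize_mdeg_lt.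
elim: k p lek => [|k IH] p lek hp.
  by apply/mpolyP => u; rewrite mcoeff0; apply: memN_msupp_eq0; apply/negP => /lek.
have dp j : mderiv j p = 0.
  apply: IH => [u hu|x Vx].
    have : (mnm_add u (mnm1 j)) \in msupp p.
      rewrite mcoeff_msupp; move: hu; rewrite mcoeff_msupp mcoeff_deriv.
      by apply: contraNneq => ->; rewrite mul0rn.
    by move/lek; rewrite mdegD mdeg1 addn1.
  have [_ /(_ j) dp] := smooth_polyP p x.
  rewrite -(derive_val (is_derive := dp)) -/(partial j _ x).
  rewrite (partial_near j (g := cst 0) oV Vx) ?/partial ?derive_cst //.
have pc : p = mpolyC n (mcoeff (@mnm0 n) p).
  apply/mpolyP => u; rewrite mcoeffC; have [->|nz] := eqVneq u (@mnm0 n).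
    by rewrite mulr1.
  rewrite mulr0; have [j uj] : exists j, u j != 0%N.
    apply: contrapT => no; case/eqP: nz; apply/mnmP => j; rewrite mnm0E.
    by apply/eqP; apply: contrapT => /negP nz; apply: no; exists j.
  have := congr1 (mcoeff (mnm_sub u (mnm1 j))) (dp j).
  rewrite mcoeff_deriv mcoeff0 submK ?lep1mP // => /eqP.
  by rewrite -mulr_natr mulf_eq0 pnatr_eq0 orbF => /eqP.
by have := hp x0 Vx0; rewrite pc /eval mevalC => ->; rewrite mpolyC0.
Qed.

End PolynomialCalculus.

(** * Rational hypergeometric functions and the singular locus *)

Section HypergeometricConsequences.

Variables (K : numFieldType) (d n : nat) (A : 'M[int]_(d, n)).
Implicit Types (p P Q a b : mpoly n K) (x y : 'rV[K]_n) (V U : set 'rV[K]_n).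

Lemma hypergeometric_euler (alpha : 'cV[int]_d) U P Q : U !=set0 ->
  (forall x, U x -> eval Q x != 0) ->
  A_hypergeometric A (map_mx intr alpha) U (fun x => eval P x / eval Q x) ->
  forall i, euler A i P * Q - P * euler A i Q = (alpha i 0)%:~R *: (P * Q).
Proof.
move=> Une Q0 [[oU _] _ hE] i; apply/eqP; rewrite -subr_eq0; apply/eqP.
apply: (eval_open_eq0 oU Une) => x Ux.
have := hE i x Ux; rewrite mxE => e.
have Qx := Q0 x Ux.
have ev T : eval (euler A i T) x
    = \sum_(j < n) (A i j)%:~R * (x 0 j * eval (mderiv j T) x).
  rewrite /euler /eval rmorph_sum /=; apply: eq_bigr => j _.
  by rewrite mevalZ mevalM mevalXU.
have e1 j : partial j (fun x => eval P x / eval Q x : K^o) x =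
    (eval (mderiv j P) x * eval Q x - eval P x * eval (mderiv j Q) x)
      / eval Q x ^+ 2.
  rewrite (partial_fraction (P := P) (Q := Q) (k := 1) j oU Q0 _ Ux) //.
  rewrite /eval rmorphB !rmorphM rmorph_nat /=; congr (_ / _); ring.
have e2 : eval P x * eval Q x * (alpha i 0)%:~R
    = eval (euler A i P) x * eval Q x - eval P x * eval (euler A i Q) x.
  have -> : eval P x * eval Q x * (alpha i 0)%:~R
      = (alpha i 0)%:~R * (eval P x / eval Q x) * eval Q x ^+ 2 by field.
  rewrite -e !ev mulr_suml mulr_suml mulr_sumr -sumrB; apply: eq_bigr => j _.
  by rewrite e1; field.
rewrite /eval !rmorphB !rmorphM /= mevalZ mevalM -/(eval _ _) in e2 *.
by rewrite -e2; ring.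
Qed.

(** Off the zeros of [b] the function is [a / b], and both derivatives have
    the same power of [b] as denominator. *)
Lemma hypergeometric_numer (alpha : 'cV[K]_d) U P Q a b (u v : 'cV[nat]_n) :
  U !=set0 -> (forall x, U x -> eval Q x != 0) ->
  A_hypergeometric A alpha U (fun x => eval P x / eval Q x) ->
  Q * a = P * b -> b != 0 ->
  A *m map_mx Posz u = A *m map_mx Posz v ->
  size (deriv_word u) = size (deriv_word v) ->
  numer a b (deriv_word u) = numer a b (deriv_word v).
Proof.
move=> Une Q0 [[oU _] hB _] eab b0 eA esz.
pose V := U `&` [set x | eval b x != 0].
have oV : open V by apply: openI => //; exact: open_eval_neq0.
have Vne : V !=set0.
  apply: contrapT => nV; case/eqP: b0; apply: (eval_open_eq0 oU Une) => x Ux.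
  by apply/eqP; apply: contrapT => /negP nz; apply: nV; exists x.
have b0V y : V y -> eval b y != 0 by case.
have fV y : V y -> eval P y / eval Q y = eval a y / eval b y.
  move=> [Uy by0]; apply/eqP; rewrite eqr_div ?Q0 // -!evalM.
  by rewrite -eab mulrC.
apply/eqP; rewrite -subr_eq0; apply/eqP; apply: (eval_open_eq0 oV Vne) => x Vx.
have := hB u v eA x (proj1 Vx); rewrite !partials_deriv_word.
rewrite !(partials_word _ oV b0V fV Vx) esz.
have bx := b0V x Vx; move/(mulIf _) => h.
rewrite /eval rmorphB /= -!/(eval _ _) h ?subrr //.
by rewrite invr_eq0 expf_neq0.
Qed.

(** At the point [t = 1] the singularity conditions are linear: the kernel of
    [A] lies in the locus defining the discriminant. *)
Lemma kernel_singular_locus x : (forall k, \sum_j (A k j)%:~R * x 0 j = 0) ->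
  \sum_j x 0 j = 0 -> singular_locus A x.
Proof.
move=> hA h1; pose t1 : 'rV[K]_d := const_mx 1.
have t1E k : t1 0 k = 1 by rewrite mxE.
have dz k (z : int) v : is_derive t1 v (fun t : 'rV[K]_d => t 0 k ^ z : K^o)
    (z%:~R * v 0 k).
  have dc := is_derive_coord t1 v k.
  have dX m : is_derive t1 v (fun t : 'rV[K]_d => t 0 k ^+ m : K^o)
      (m%:R * v 0 k).
    have := is_deriveX m dc; rewrite t1E expr1n mulr1.
    rewrite (_ : (fun y : 'rV[K]_d => y 0 k : K^o) ^+ m =
      (fun t : 'rV[K]_d => t 0 k ^+ m : K^o)) //.
    apply/funext => t; elim: m => // m IH.
    by rewrite !exprS -IH.
  case: z => m; first exact: dX.
  have dm := dX m.+1.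
  have nz : t1 0 k ^+ m.+1 != 0 by rewrite t1E expr1n oner_eq0.
  pose g := (fun t : 'rV[K]_d => t 0 k ^+ m.+1 : K^o).
  have dV := derivableV (f := g) nz (ex_derive (is_derive := dm)).
  have dW := deriveV (f := g) nz (ex_derive (is_derive := dm)).
  have -> : (fun t : 'rV[K]_d => t 0 k ^ Negz m : K^o) = (fun t => (g t)^-1).
    by apply/funext.
  apply: DeriveDef; first exact: dV.
  rewrite dW (derive_val (is_derive := dm)) /g t1E !expr1n invr1.
  by rewrite NegzE rmorphN /= mulNr scaleN1r.
have dp (r : seq 'I_d) j v :
    is_derive t1 v (fun t : 'rV[K]_d => \prod_(k <- r) t 0 k ^ A k j : K^o)
      (\sum_(k <- r) (A k j)%:~R * v 0 k).
  elim: r => [|k r IH].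
    rewrite big_nil (_ : (fun _ => _) = cst (1 : K^o)); first exact: is_derive_cst.
    by apply/funext => t; rewrite big_nil.
  rewrite big_cons (_ : (fun _ => _) =
     (fun t : 'rV[K]_d => t 0 k ^ A k j : K^o) *
     (fun t : 'rV[K]_d => \prod_(k <- r) t 0 k ^ A k j : K^o)); last first.
    by apply/funext => t; rewrite big_cons.
  apply: (is_derive_eq (is_deriveM (dz k (A k j) v) IH)).
  have -> : \prod_(l <- r) t1 0 l ^ A l j = 1.
    by apply: big1 => l _; rewrite t1E exp1rz.
  by rewrite t1E exp1rz !scale1r addrC.
have ds (r : seq 'I_n) v :
    is_derive t1 v (fun t : 'rV[K]_d =>
       \sum_(j <- r) x 0 j * \prod_(k < d) t 0 k ^ A k j : K^o)
      (\sum_(j <- r) x 0 j * \sum_k (A k j)%:~R * v 0 k).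
  elim: r => [|j r IH].
    rewrite big_nil (_ : (fun _ => _) = cst (0 : K^o)); first exact: is_derive_cst.
    by apply/funext => t; rewrite big_nil.
  rewrite big_cons (_ : (fun _ => _) =
     (x 0 j \*: (fun t : 'rV[K]_d => \prod_(k < d) t 0 k ^ A k j : K^o)) +
     (fun t : 'rV[K]_d => \sum_(j <- r) x 0 j * \prod_(k < d) t 0 k ^ A k j : K^o)); last first.
    by apply/funext => t; rewrite big_cons.
  exact: (is_deriveD (is_deriveZ _ (dp _ j v)) IH).
exists t1; split=> [k||k]; first by rewrite t1E oner_eq0.
  rewrite /generic_poly -[RHS]h1; apply: eq_bigr => j _.
  by rewrite big1 ?mulr1 // => k _; rewrite t1E exp1rz.
rewrite /partial (derive_val (is_derive := ds _ _)) -[RHS](hA k).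
apply: eq_bigr => j _; rewrite (bigD1 k) //= big1 => [|l ne].
  by rewrite mxE !eqxx mulr1 addr0 mulrC.
by rewrite mxE eqxx (negPf ne) mulr0.
Qed.

End HypergeometricConsequences.

(** * Relations of circuits and Gale duals *)

Section Circuits.

Variables (d n : nat) (A : 'M[int]_(d, n)).
Implicit Types (I J : {set 'I_n}).

Lemma dependentP J : reflect
  (exists r : 'cV[rat]_n, [/\ r != 0, forall j, j \notin J -> r j 0 = 0
    & ratmx A *m r = 0]) (dependent A J).
Proof.
pose X := map_tuple (fun j => col j (ratmx A)) (enum_tuple J).
have mulE (r : 'cV[rat]_n) : (forall j, j \notin J -> r j 0 = 0) ->
    ratmx A *m r = \sum_(i < #|J|) r (enum_val i) 0 *: X`_i.
  move=> hr; have -> : ratmx A *m r = \sum_j r j 0 *: col j (ratmx A).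
    apply/matrixP => i k; rewrite ord1 !mxE summxE; apply: eq_bigr => j _.
    by rewrite !mxE mulrC.
  rewrite (bigID [in J]) /= [X in _ + X]big1 ?addr0 => [|j nJ]; last first.
    by rewrite hr // scale0r.
  rewrite big_enum_val; apply: eq_bigr => i _; congr (_ *: _).
  rewrite (nth_map (enum_val i)) -?cardE //.
  by rewrite -enum_val_nth.
apply: (iffP idP) => [nf|[r [r0 hr e]]].
  apply: contrapT => no; case/negP: nf; apply/(@freeP _ _ _ X) => k e i.
  pose r : 'cV[rat]_n := \col_j (\sum_(i' < #|J| | enum_val i' == j) k i').
  have rE i' : r (enum_val i') 0 = k i'.
    rewrite mxE (bigD1 i') //= big1 ?addr0 // => i2 /andP[/eqP /enum_val_inj -> ].
    by rewrite eqxx.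
  have hr j : j \notin J -> r j 0 = 0.
    move=> nJ; rewrite mxE big1 // => i' /eqP e'.
    by case/negP: nJ; rewrite -e' enum_valP.
  rewrite -rE; have [->|r0] := eqVneq r 0; first by rewrite mxE.
  case: no; exists r; split => //; rewrite mulE // -[RHS]e.
  by apply: eq_bigr => i' _; rewrite rE.
apply/negP => /(@freeP _ _ _ X) fX; case/eqP: r0.
apply/matrixP => j k; rewrite ord1 mxE.
have [jJ|/hr //] := boolP (j \in J).
rewrite -(enum_rankK_in jJ jJ).
by apply: (fX (fun i => r (enum_val i) 0)); rewrite -mulE.
Qed.

Lemma clear_denominators p (r : 'cV[rat]_p) : exists (N : int) (c : 'cV[int]_p),
  0 < N /\ forall i, N%:~R * r i 0 = (c i 0)%:~R.
Proof.
exists (\prod_i denq (r i 0)), (\col_i (numq (r i 0) * \prod_(j | j != i) denq (r j 0))).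
split; first by apply: prodr_gt0 => i _; exact: denq_gt0.
move=> i; rewrite mxE (bigD1 i) //= !rmorphM /= mulrAC; congr (_ * _).
by rewrite numqE mulrC.
Qed.

Lemma ratmx_eq0 p q (M : 'M[int]_(p, q)) : ratmx M = 0 -> M = 0.
Proof.
move=> /matrixP h; apply/matrixP => i j; have := h i j; rewrite !mxE => /eqP.
by rewrite intr_eq0 => /eqP.
Qed.

(** By minimality the rational relation supported in a circuit vanishes nowhere
    on it. *)
Lemma circuit_primitive_relation I : circuit A I ->
  exists c, primitive_relation A I c.
Proof.
move=> /minsetP[/dependentP[r [r0 hr er]] minI].
have [N [c0 [N0 hc0]]] := clear_denominators r.
have c0E i : (c0 i 0 == 0) = (r i 0 == 0).
  by rewrite -(intr_eq0 rat) -hc0 mulf_eq0 intr_eq0 gt_eqF.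
have c0I i : (c0 i 0 != 0) = (i \in I).
  rewrite c0E; apply/idP/idP => [|iI]; first by apply: contraNT => /hr ->.
  apply/negP => /eqP ri; have : dependent A (I :\ i).
    apply/dependentP; exists r; split => // j; rewrite !inE negb_and negbK.
    by case/orP => [/eqP ->|/hr].
  move=> /minI /(_ (subD1set _ _)) => e.
  by move: iI; rewrite -e !inE eqxx.
have Ac0 : A *m c0 = 0.
  apply: ratmx_eq0; have -> : ratmx (A *m c0) = N%:~R *: (ratmx A *m r).
    rewrite scalemxAr /ratmx map_mxM; congr (_ *m _).
    by apply/matrixP => i j; rewrite ord1 !mxE; exact/esym/hc0.
  by rewrite er scaler0.
pose g := \big[gcdn/0%N]_(i in I) absz (c0 i 0).
have gdv i : i \in I -> (g %| absz (c0 i 0)%R)%N.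
  by move=> iI; rewrite /g (bigD1 i) //= dvdn_gcdl.
have g0 : (0 < g)%N.
  have [i iI] : exists i, i \in I.
    apply: contrapT => no; case/eqP: r0; apply/matrixP => j k.
    by rewrite ord1 mxE hr //; apply/negP => jI; apply: no; exists j.
  by apply: dvdn_gt0 (gdv i iI); rewrite absz_gt0 c0I.
pose c : 'cV[int]_n := \col_i (c0 i ord0 %/ g%:Z)%Z.
have cE i : c0 i 0 = c i 0 * g%:Z.
  rewrite mxE divzK // dvdzE absz_nat.
  have [/gdv //|] := boolP (i \in I).
  by rewrite -c0I negbK => /eqP ->; rewrite dvdn0.
have gz : g%:Z != 0 by rewrite -lt0n.
exists c; split.
- apply/matrixP => i j; rewrite ord1 [RHS]mxE; apply: (mulIf gz); rewrite mul0r.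
  have /matrixP/(_ i 0) := Ac0; rewrite !mxE => e; rewrite -[RHS]e mulr_suml.
  by apply: eq_bigr => k _; rewrite cE mulrA.
- by move=> i; rewrite -c0I cE mulf_eq0 (negPf gz) orbF.
apply/eqP; rewrite -(eqn_pmul2l g0) muln1; apply/eqP.
rewrite (big_morph (muln g) (muln_gcdr g) (muln0 g)).
by apply: eq_bigr => i _; rewrite cE abszM mulnC.
Qed.

End Circuits.

Section GaleLattice.

Variables (d n : nat) (A : 'M[int]_(d, n)) (B : 'M[int]_(n, 2)).
Hypotheses (n2 : (2 <= n)%N) (AB : gale_dual A B).

Let AB0 : A *m B = 0 := AB.1.

Lemma gale_ker (v : 'cV[int]_n) : A *m v = 0 -> exists w, v = B *m w.
Proof. by case: AB => _ /(_ v) h /h [w [-> _]]; exists w. Qed.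

Lemma gale_inj (w : 'cV[int]_2) : B *m w = 0 -> w = 0.
Proof.
move=> e; have [_ /(_ 0)] := AB; rewrite mulmx0 => /(_ erefl) [w' [_ u]].
by rewrite -(u w) ?e // -(u 0) ?mulmx0.
Qed.

(** The lattice of relations is saturated, so the elementary divisors of a Gale
    dual are units and it has an integral left inverse. *)
Lemma gale_left_inverse : exists L : 'M[int]_(2, n), L *m B = 1%:M.
Proof.
have [L uL [R uR [s _ eB]]] := int_Smith_normal_form B.
pose D : 'M[int]_(n, 2) := \matrix_(i, j) (s`_i *+ (i == j :> nat)).
have sun (k : 'I_2) : exists y, y * s`_k = 1.
  pose k' : 'I_n := widen_ord n2 k.
  have e1 : B *m (invmx R *m delta_mx k 0) = s`_k *: (L *m delta_mx k' (0 : 'I_1)).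
    rewrite {1}eB -!mulmxA mulKVmx // scalemxAr; congr (_ *m _).
    apply/matrixP => i j; rewrite ord1 !mxE (bigD1 k) //= big1 => [|l ne].
      rewrite !mxE !eqxx mulr1 addr0 -val_eqE /=.
      by case: eqP => [->|_]; rewrite ?mulr1n ?mulr1 ?mulr0n ?mulr0.
    by rewrite !mxE (negPf ne) mulr0.
  have sk : s`_k != 0.
    apply/eqP => z; move: e1; rewrite z scale0r => /gale_inj.
    move=> /(congr1 (mulmx R)); rewrite mulKVmx // mulmx0.
    by move/matrixP/(_ k 0)/eqP; rewrite !mxE !eqxx.
  have [|w ew] := @gale_ker (L *m delta_mx k' 0).
    have : s`_k *: (A *m (L *m delta_mx k' (0 : 'I_1))) = 0.
      by rewrite scalemxAr -e1 mulmxA AB0 mul0mx.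
    move/matrixP => h; apply/matrixP => i j; have := h i j.
    by rewrite [LHS]mxE [RHS]mxE => /eqP; rewrite mulf_eq0 (negPf sk) => /eqP ->; rewrite mxE.
  have e2 : invmx R *m delta_mx k 0 = s`_k *: w.
    apply/eqP; rewrite -subr_eq0; apply/eqP/gale_inj.
    by rewrite mulmxBr e1 ew -scalemxAr subrr.
  exists ((R *m w) k 0).
  have := congr1 (mulmx R) e2; rewrite mulKVmx // -scalemxAr => /matrixP/(_ k 0).
  by rewrite mxE [RHS]mxE !eqxx mulrC => <-.
have [y hy] := choice sun.
pose E : 'M[int]_(2, n) := \matrix_(i, j) (y i *+ (i == j :> nat)).
exists (invmx R *m E *m invmx L).
have ED : E *m D = 1%:M.
  apply/matrixP => i j; rewrite !mxE (bigD1 (widen_ord n2 i)) //= big1 => [|l ne].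
    rewrite !mxE /= eqxx mulr1n addr0 -val_eqE /=.
    by case: (_ == _ :> nat); rewrite ?mulr1n ?hy ?mulr0n ?mulr0.
  rewrite !mxE; case: eqP => [e|_]; last by rewrite mulr0n mul0r.
  by case/eqP: ne; apply/val_inj; rewrite /= e.
rewrite eB -/D -!mulmxA mulKmx // (mulmxA E) ED mul1mx mulVmx //.
Qed.

Lemma gale_rational_ker (r : 'cV[rat]_n) i : row i B = 0 ->
  ratmx A *m r = 0 -> r i 0 = 0.
Proof.
move=> Bi er; have [N [c [N0 hc]]] := clear_denominators r.
have [|w ew] := @gale_ker c.
  apply: ratmx_eq0; have -> : ratmx (A *m c) = N%:~R *: (ratmx A *m r).
    rewrite scalemxAr /ratmx map_mxM; congr (_ *m _).
    by apply/matrixP => j k; rewrite ord1 !mxE; exact/esym/hc.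
  by rewrite er scaler0.
have ci : c i 0 = 0.
  have -> : c i 0 = (row i B *m w) 0 0 by rewrite -row_mul -ew mxE.
  by rewrite Bi mul0mx mxE.
have := hc i; rewrite ci => /eqP; rewrite mulf_eq0 intr_eq0 gt_eqF //=.
by move/eqP.
Qed.

(** If the row vanishes, the corresponding coordinate form is zero on the
    rational kernel, hence a combination of the rows of [A]: a hyperplane
    through the other points. *)
Lemma gale_row_neq0 i : ~ all_but_one_on_hyperplane A -> row i B != 0.
Proof.
move=> nH; apply/eqP => Bi; apply: nH.
have : ((delta_mx 0 i : 'rV[rat]_n) <= ratmx A)%MS.
  rewrite submxE; apply/eqP/matrixP => a j; rewrite ord1 -rowE [RHS]mxE.
  have := @gale_rational_ker (col j (cokermx (ratmx A))) i Bi.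
  by rewrite colE mulmxA mulmx_coker mul0mx -colE => /(_ erefl); rewrite !mxE.
case/submxP => w ew; exists w, 0, i; split.
  apply/eqP => w0; move: ew; rewrite w0 mul0mx => /matrixP/(_ 0 i)/eqP.
  by rewrite !mxE !eqxx.
move=> j; have -> : w *m col j (ratmx A) = (j == i)%:R%:M.
  rewrite colE mulmxA -ew -colE; apply/matrixP => a b; rewrite !ord1 !mxE eqxx /=.
  by rewrite mulr1n.
have [_|_] := eqVneq j i; split=> //.
by move=> /matrixP/(_ 0 0)/eqP; rewrite !mxE !eqxx.
Qed.

End GaleLattice.

(** * Coordinates adapted to a circuit *)

(** Coordinates on the lattice of relations adapted to a circuit [I]: the first
    basis vector [cc] is the relation of the circuit, the second one [bb] is
    normalized by the sign of its sum off [I], and [C1], [C2] are nonnegative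
    linear forms restricting to the dual basis. *)
Record circuit_frame (d n : nat) (A : 'M[int]_(d, n)) (I : {set 'I_n})
    (cc bb : 'I_n -> int) (C1 C2 : 'I_n -> nat) : Prop := CircuitFrame {
  frame_supp : forall j, (cc j != 0) = (j \in I);
  frame_bb : forall j, j \notin I -> bb j != 0;
  frame_pos : 0 < \sum_(j | j \notin I) bb j;
  frame_Acc : forall i, \sum_j A i j * cc j = 0;
  frame_Abb : forall i, \sum_j A i j * bb j = 0;
  frame_cc : \sum_j cc j = 0;
  frame_bb0 : \sum_j bb j = 0;
  frame_C1cc : \sum_j (C1 j)%:Z * cc j = 1;
  frame_C1bb : \sum_j (C1 j)%:Z * bb j = 0;
  frame_C2cc : \sum_j (C2 j)%:Z * cc j = 0;
  frame_C2bb : \sum_j (C2 j)%:Z * bb j = 1;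
  frame_ker : forall v : 'I_n -> int, (forall i, \sum_j A i j * v j = 0) ->
    forall j, v j = cc j * (\sum_l (C1 l)%:Z * v l)
                  + bb j * (\sum_l (C2 l)%:Z * v l);
  frame_unb :
    ~ perm_eq [seq cc j | j <- enum 'I_n] [seq - cc j | j <- enum 'I_n]
}.

Section FrameExistence.

Variables (d n : nat) (A : 'M[int]_(d, n)) (I : {set 'I_n}).

(** A change of basis; it does not move [bb] off [I], where [cc] vanishes. *)
Lemma frame_shear cc bb C1 C2 (M : nat) : circuit_frame A I cc bb C1 C2 ->
  circuit_frame A I cc (fun j => bb j - M%:Z * cc j)
    (fun j => C1 j + M * C2 j)%N C2.
Proof.
case=> s b p Ac Ab c0 b0 c1 b1 c2 b2 k u.
have cz j : j \notin I -> cc j = 0 by rewrite -s negbK => /eqP.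
have lin (f : 'I_n -> int) : \sum_j f j * (bb j - M%:Z * cc j)
    = \sum_j f j * bb j - M%:Z * \sum_j f j * cc j.
  by rewrite mulr_sumr -sumrB; apply: eq_bigr => j _; ring.
have linC (v : 'I_n -> int) : \sum_j (C1 j + M * C2 j)%N%:Z * v j
    = \sum_j (C1 j)%:Z * v j + M%:Z * \sum_j (C2 j)%:Z * v j.
  rewrite mulr_sumr -big_split; apply: eq_bigr => j _ /=.
  by rewrite PoszD PoszM; ring.
split=> //.
- by move=> j jI; rewrite cz // mulr0 subr0 b.
- by rewrite (eq_bigr bb) // => j jI; rewrite cz // mulr0 subr0.
- by move=> i; rewrite lin Ab Ac mulr0 subr0.
- by rewrite sumrB -mulr_sumr b0 c0 mulr0 subr0.
- by rewrite linC c1 c2 mulr0 addr0.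
- by rewrite linC !lin c1 b1 c2 b2; ring.
- by rewrite lin c2 b2 mulr0 subr0.
- by move=> v /k e j; rewrite linC {1}e; ring.
Qed.

Variable B : 'M[int]_(n, 2).
Hypotheses (n2 : (2 <= n)%N) (AB : gale_dual A B).
Hypothesis nc : nonconfluent A.

Lemma nonconfluent_int : exists (N : nat) (y : 'rV[int]_d),
  (0 < N)%N /\ forall j, \sum_i y 0 i * A i j = N%:Z.
Proof.
have [w ew] := submxP nc.
have [N [y [N0 hy]]] := clear_denominators w^T.
exists (absz N), y^T; split=> [|j]; first by rewrite absz_gt0 gt_eqF.
rewrite gtz0_abs //; apply/eqP; rewrite -(eqr_int rat) rmorph_sum /=.
have := congr1 (fun u : 'rV_n => N%:~R * u 0 j) ew; rewrite !mxE mulr1 => ->.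
rewrite mulr_sumr; apply/eqP/eq_bigr => i _; rewrite !mxE rmorphM /= mulrA.
by rewrite -hy mxE.
Qed.

Lemma ker_sum0 (v : 'I_n -> int) : (forall i, \sum_j A i j * v j = 0) ->
  \sum_j v j = 0.
Proof.
have [N [y [N0 hy]]] := nonconfluent_int => hv.
have Nz : N%:Z != 0 by rewrite -lt0n.
apply: (mulfI Nz); rewrite mulr0 mulr_sumr.
transitivity (\sum_j \sum_i y 0 i * (A i j * v j)).
  apply: eq_bigr => j _; rewrite -(hy j) mulr_suml.
  by apply: eq_bigr => i _; rewrite mulrA.
by rewrite exchange_big big1 // => i _; rewrite -mulr_sumr hv mulr0.
Qed.

(** Adding a multiple of the row [(1, ..., 1)] makes a linear form on the
    exponents nonnegative without changing it on relations. *)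
Lemma nonneg_form (c : 'I_n -> int) : exists C : 'I_n -> nat,
  forall v : 'I_n -> int, \sum_j v j = 0 ->
    \sum_j (C j)%:Z * v j = \sum_j c j * v j.
Proof.
pose t := (\sum_j absz (c j))%N%:Z.
exists (fun j => absz (c j + t)) => v hv.
transitivity (\sum_j c j * v j + t * \sum_j v j); last by rewrite hv mulr0 addr0.
rewrite mulr_sumr -big_split; apply: eq_bigr => j _; rewrite /= -mulrDl.
congr (_ * _); rewrite gez0_abs // /t (bigD1 j) //= PoszD.
by lia.
Qed.

Hypothesis nH : ~ all_but_one_on_hyperplane A.
Hypotheses (cI : circuit A I) (unb : ~ balanced A I) (nspl : ~ splitting B I).

Let AE (v : 'cV[int]_n) i : (A *m v) i 0 = \sum_j A i j * v j 0.
Proof. by rewrite mxE. Qed.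

(** The relation of the circuit is [B *m w] with [w] primitive; a Bezout
    relation completes [w] to a basis of the plane, and [z] is the second
    vector. *)
Lemma circuit_frame_exists : exists cc bb C1 C2, circuit_frame A I cc bb C1 C2.
Proof.
have [c pc] := circuit_primitive_relation cI.
have [Ac cI' gc] := pc.
have [w ew] := gale_ker AB Ac.
have BE (z : 'cV[int]_2) j : (B *m z) j 0 = B j 0 * z 0 0 + B j 1 * z 1 0.
  by rewrite mxE big_ord_recl big_ord1; congr (_ * _ + B j _ * z _ _); apply/val_inj.
have cw : coprimez (w 0 0) (w 1 0).
  pose g := gcdz (w 0 0) (w 1 0).
  have gdv j : (absz g %| absz (c j ord0)%R)%N.
    rewrite -dvdzE ew BE.
    by apply: rpredD; apply: dvdz_mull; [apply: dvdz_gcdl|apply: dvdz_gcdr].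
  have : (absz g %| 1)%N.
    rewrite -gc; apply: (big_ind (fun m => (absz g %| m)%N)) => //.
    by move=> a b ha hb; rewrite dvdn_gcd ha.
  by rewrite dvdn1 /coprimez.
have [[x y] /= exy] : exists xy : int * int, xy.1 * w 0 0 + xy.2 * w 1 0 = 1.
  by have [u [v e]] := Bezoutz (w 0 0) (w 1 0); exists (u, v); rewrite /= e; apply/eqP.
pose z : 'cV[int]_2 := \col_i (if i == 0 then - y else x).
have z0 : z 0 0 = - y by rewrite mxE eqxx.
have z1 : z 1 0 = x by rewrite mxE.
have zw (s : 'cV[int]_2) : s = (x * s 0 0 + y * s 1 0) *: w
    + (w 0 0 * s 1 0 - w 1 0 * s 0 0) *: z.
  apply/matrixP => i k; rewrite ord1 !mxE.
  have [-> /=|ni] := eqVneq i 0.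
    by rewrite -[LHS]mul1r -exy; ring.
  have -> : i = 1 by case: i ni => [[|[|i]] lt] // _; apply/val_inj.
  by rewrite /= -[LHS]mul1r -exy; ring.
have [L LB] := gale_left_inverse n2 AB.
pose b := B *m z.
have key (p0 p1 : int) : p0 * w 0 0 + p1 * w 1 0 = 0 -> x * p1 - y * p0 = 0 ->
    p0 = 0 /\ p1 = 0.
  move=> e1 e2; split.
    have -> : p0 = p0 * 1 by rewrite mulr1.
    rewrite -exy; have -> : p0 * (x * w 0 0 + y * w 1 0)
      = x * (p0 * w 0 0 + p1 * w 1 0) - w 1 0 * (x * p1 - y * p0) by ring.
    by rewrite e1 e2 !mulr0 subrr.
  have -> : p1 = p1 * 1 by rewrite mulr1.
  rewrite -exy; have -> : p1 * (x * w 0 0 + y * w 1 0)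
    = y * (p0 * w 0 0 + p1 * w 1 0) + w 0 0 * (x * p1 - y * p0) by ring.
  by rewrite e1 e2 !mulr0 addr0.
have bE j : b j 0 = x * B j 1 - y * B j 0.
  by rewrite /b BE z0 z1; ring.
have cE j : c j 0 = B j 0 * w 0 0 + B j 1 * w 1 0 by rewrite ew BE.
have ord2 (k : 'I_2) : k = 0 \/ k = 1.
  by case: k => [[|[|k]] lt] //; [left|right]; apply/val_inj.
have rowB j : c j 0 = 0 -> b j 0 = 0 -> row j B = 0.
  rewrite cE bE => e1 e2; have [h0 h1] := key _ _ e1 e2.
  by apply/rowP => k; rewrite !mxE; case: (ord2 k) => ->.
have cI0 j : j \notin I -> c j 0 = 0 by rewrite -cI' negbK => /eqP.
have spl0 : \sum_(j | j \notin I) b j 0 != 0.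
  apply/eqP => sb0; apply: nspl; rewrite /splitting.
  have h0 : \sum_(j | j \notin I) c j 0 = 0 by apply: big1.
  have [|| p0 p1] := key (\sum_(j | j \notin I) B j 0) (\sum_(j | j \notin I) B j 1).
  - by rewrite -[RHS]h0 !mulr_suml -big_split; apply: eq_bigr => j _; rewrite cE.
  - by rewrite -[RHS]sb0 !mulr_sumr -sumrB; apply: eq_bigr => j _; rewrite bE.
  apply/rowP => k; rewrite summxE !mxE.
  rewrite (eq_big (fun j => j \notin I) (fun j => B j k)) => [|j|j _].
  - by case: (ord2 k) => ->.
  - by rewrite inE.
  - by rewrite mxE.
pose sg : int := if 0 < \sum_(j | j \notin I) b j 0 then 1 else -1.
have sg2 : sg * sg = 1 by rewrite /sg; case: ifP => _; rewrite ?mulrNN mulr1.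
pose cc j := c j 0; pose bb j := sg * b j 0.
pose l1 j := x * L 0 j + y * L 1 j.
pose l2 j := sg * (w 0 0 * L 1 j - w 1 0 * L 0 j).
have [C1 hC1] := nonneg_form l1; have [C2 hC2] := nonneg_form l2.
exists cc, bb, C1, C2.
have Lv (s : 'cV[int]_2) i : \sum_j L i j * (B *m s) j 0 = s i 0.
  have := mulmxA L B s; rewrite LB mul1mx => /matrixP/(_ i 0).
  by rewrite mxE.
have l1E (s : 'cV[int]_2) :
    \sum_j l1 j * (B *m s) j 0 = x * s 0 0 + y * s 1 0.
  rewrite -!Lv !mulr_sumr -big_split; apply: eq_bigr => j _.
  by rewrite /l1 /=; ring.
have l2E (s : 'cV[int]_2) : \sum_j l2 j * (B *m s) j 0
    = sg * (w 0 0 * s 1 0 - w 1 0 * s 0 0).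
  rewrite -(Lv s 1) -(Lv s 0) !mulr_sumr -sumrB mulr_sumr; apply: eq_bigr => j _.
  by rewrite /l2 /=; ring.
have Acc i : \sum_j A i j * cc j = 0 by rewrite -AE Ac mxE.
have Ab i : \sum_j A i j * b j 0 = 0 by rewrite -AE /b mulmxA AB.1 mul0mx mxE.
have sb (f : 'I_n -> int) : \sum_j f j * bb j = sg * \sum_j f j * b j 0.
  by rewrite mulr_sumr; apply: eq_bigr => j _; rewrite /bb; ring.
have Abb i : \sum_j A i j * bb j = 0 by rewrite sb Ab mulr0.
have ccE j : cc j = (B *m w) j 0 by rewrite /cc ew.
have sumc := ker_sum0 Acc; have sumb := ker_sum0 Abb.
split=> //.
- move=> j jI; rewrite /bb mulf_neq0 //.
    by rewrite /sg; case: ifP.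
  apply/eqP => bj; case/eqP: (gale_row_neq0 AB j nH); apply: rowB => //.
  exact: cI0.
- rewrite /bb -mulr_sumr /sg; case: ifP => [|/negbT]; rewrite ?mul1r // => h.
  by rewrite mulN1r oppr_gt0 lt_neqAle spl0 /= leNgt.
- by rewrite hC1 // (eq_bigr (fun j => l1 j * (B *m w) j 0)) ?l1E // => j _; rewrite ccE.
- rewrite hC1 // sb l1E z0 z1; ring.
- rewrite hC2 // (eq_bigr (fun j => l2 j * (B *m w) j 0)) => [|j _]; last by rewrite ccE.
  by rewrite l2E; ring.
- rewrite hC2 // sb l2E z0 z1 mulrA sg2 mul1r -exy. ring.
- move=> v hv j; have hv0 := ker_sum0 hv; rewrite hC1 // hC2 //.
  pose v' : 'cV[int]_n := \col_j v j.
  have [|s es] := gale_ker AB (v := v').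
    apply/matrixP => i k; rewrite ord1 AE mxE -[RHS](hv i).
    by apply: eq_bigr => l _; rewrite mxE.
  have vE l : v l = (B *m s) l 0 by rewrite -es mxE.
  rewrite (eq_bigr (fun l => l1 l * (B *m s) l 0)) => [|l _]; last by rewrite vE.
  rewrite l1E (eq_bigr (fun l => l2 l * (B *m s) l 0)) => [|l _]; last by rewrite vE.
  rewrite l2E vE {1}(zw s) mulmxDr -!scalemxAr mxE [X in X + _]mxE [X in _ + X]mxE.
  rewrite ccE /bb -/b; set X := w 0 0 * _ - _.
  have -> : sg * b j 0 * (sg * X) = sg * sg * (X * b j 0) by ring.
  by rewrite sg2 mul1r [in RHS]mulrC.
move=> pe; apply: unb; exists c => //.
have f (g : int -> int) : (forall t, (g t != 0) = (t != 0)) ->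
    [seq t <- [seq g (cc j) | j <- enum 'I_n] | t != 0]
    = [seq g (c i 0) | i <- enum I].
  move=> hg; rewrite filter_map; congr map.
  rewrite enumT; apply: eq_filter => j /=.
  by rewrite hg cI'.
have := perm_filter (fun t => t != 0) pe.
by rewrite (f id) // (f -%R) // => t; rewrite oppr_eq0.
Qed.

End FrameExistence.

(** * Rehomogenization *)

Section Lift.

Variables (K : numFieldType) (n : nat) (cc bb : 'I_n -> int) (C1 C2 : 'I_n -> nat).
Implicit Types (v : 'I_n -> int) (g : {poly {poly K}}).

Definition lexp v (m k : nat) : multinom n :=
  Multinom [tuple absz (v j + cc j * m%:Z + bb j * k%:Z)%R | j < n].

(** An inverse, up to a monomial, of [dehom] on the homogeneous polynomials of
    a given degree. *)
Definition rehom v S g : mpoly n K :=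
  \sum_(k < S) \sum_(m < S) g`_k`_m *: mpolyX K (lexp v m k).

Definition bounded_by S g : Prop :=
  forall k m, g`_k`_m != 0 -> (k < S)%N /\ (m < S)%N.

Lemma bounded_exists g : exists S, forall S', (S <= S')%N -> bounded_by S' g.
Proof.
exists (size g + \sum_(k < size g) size (g`_k)%R)%N => S' le k m nz.
have ltk : (k < size g)%N.
  rewrite ltnNge; apply: contra nz => le'.
  by rewrite [g`_k]nth_default // coef0.
have ltm : (m < size (g`_k)%R)%N.
  rewrite ltnNge; apply: contra nz => le'.
  by rewrite nth_default.
rewrite (bigD1 (Ordinal ltk)) //= in le.
split; first exact: leq_trans ltk (leq_trans (leq_addr _ _) le).
apply: leq_trans ltm (leq_trans _ le).
by apply: leq_trans (leq_addl _ _); apply: leq_addr.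
Qed.

Lemma bounded_sum S g : bounded_by S g ->
  g = \sum_(k < S) \sum_(m < S) (g`_k`_m)%:P%:P * zmon K m k.
Proof.
move=> hb; apply: bipolyP => k' m'; rewrite !coef_sum.
have cE (k m : nat) : ((g`_k`_m)%:P%:P * zmon K m k)`_k'`_m'
    = g`_k`_m * ((m' == m) && (k' == k))%:R.
  by rewrite coefCM coefCM coef_zmon.
have sE (k : nat) : (\sum_(m < S) (g`_k`_m)%:P%:P * zmon K m k)`_k'`_m'
    = \sum_(m < S) g`_k`_m * ((m' == m) && (k' == k))%:R.
  by rewrite !coef_sum; apply: eq_bigr => m _; rewrite cE.
rewrite (eq_bigr _ (fun (k : 'I_S) _ => sE k)).
have [z|nz] := eqVneq g`_k'`_m' 0.
  rewrite z big1 // => k _; rewrite big1 // => m _.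
  by case: andP => [[/eqP <- /eqP <-]|_]; rewrite ?z ?mul0r ?mulr0.
have [lk lm] := hb _ _ nz.
rewrite (bigD1 (Ordinal lk)) //= [X in _ + X]big1 ?addr0 => [|k ne].
  rewrite (bigD1 (Ordinal lm)) //= !eqxx mulr1 big1 ?addr0 // => m ne.
  case: eqP => [e|_]; last by rewrite mulr0.
  by case/eqP: ne; apply/val_inj.
rewrite big1 // => m _; case: (k' =P k) => [e|_]; last by rewrite andbF mulr0.
by case/eqP: ne; apply/val_inj.
Qed.

Hypothesis C1cc : \sum_j (C1 j)%:Z * cc j = 1.
Hypothesis C1bb : \sum_j (C1 j)%:Z * bb j = 0.
Hypothesis C2cc : \sum_j (C2 j)%:Z * cc j = 0.
Hypothesis C2bb : \sum_j (C2 j)%:Z * bb j = 1.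

Variables (v : 'I_n -> int) (S : nat).
Hypothesis v_ge0 : forall (m k : nat) j, (k < S)%N -> (m < S)%N ->
  0 <= v j + cc j * m%:Z + bb j * k%:Z.

Lemma lexpE m k j : (k < S)%N -> (m < S)%N ->
  (lexp v m k j)%:Z = v j + cc j * m%:Z + bb j * k%:Z.
Proof. by move=> lk lm; rewrite mnmE gez0_abs // v_ge0. Qed.

Lemma wgt_lexp (C : 'I_n -> nat) m k : (k < S)%N -> (m < S)%N ->
  (wgt C (lexp v m k))%:Z = \sum_j (C j)%:Z * v j
    + (\sum_j (C j)%:Z * cc j) * m%:Z + (\sum_j (C j)%:Z * bb j) * k%:Z.
Proof.
move=> lk lm; rewrite /wgt (big_morph Posz PoszD (erefl _)).
rewrite !mulr_suml -!big_split; apply: eq_bigr => j _ /=.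
by rewrite PoszM lexpE //; ring.
Qed.

Lemma homog_rehom g : homog cc bb C1 C2 (rehom v S g)
  (fun j => v j - cc j * (\sum_l (C1 l)%:Z * v l) - bb j * (\sum_l (C2 l)%:Z * v l)).
Proof.
apply: (big_ind (fun T => homog cc bb C1 C2 T _)).
- by move=> u; rewrite msupp0.
- by move=> T T'; apply: homogD.
move=> k _; apply: (big_ind (fun T => homog cc bb C1 C2 T _)).
- by move=> u; rewrite msupp0.
- by move=> T T'; apply: homogD.
move=> m _; apply: homogZ; apply: homog_eq (@homogX K n cc bb C1 C2 _) => j.
rewrite /kappa lexpE // !wgt_lexp // C1cc C1bb C2cc C2bb; ring.
Qed.

Lemma dehom_rehom g (s1 s2 r1 r2 : nat) : bounded_by S g ->
  \sum_j (C1 j)%:Z * v j + s1%:Z = r1%:Z ->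
  \sum_j (C2 j)%:Z * v j + s2%:Z = r2%:Z ->
  zmon K s1 s2 * dehom C1 C2 (rehom v S g) = zmon K r1 r2 * g.
Proof.
move=> hb e1 e2; rewrite [in RHS](bounded_sum hb) /rehom rmorph_sum !mulr_sumr.
apply: eq_bigr => k _; rewrite rmorph_sum !mulr_sumr; apply: eq_bigr => m _.
rewrite /= dehomZ dehomX [LHS]mulrCA [RHS]mulrCA !zmonM.
congr (_ * zmon K _ _); apply/eqP; rewrite -eqz_nat !PoszD.
  by rewrite wgt_lexp // -e1 C1cc C1bb; apply/eqP; ring.
by rewrite wgt_lexp // -e2 C2cc C2bb; apply/eqP; ring.
Qed.

End Lift.

(** * Unbalanced non-splitting circuits *)

Section Conclusion.

Variables (K : numFieldType) (d n : nat) (A : 'M[int]_(d, n)).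
Variables (I : {set 'I_n}).

Definition kernel_line (cc bb : 'I_n -> int) (eps : K) : 'rV[K]_n :=
  \row_j ((bb j)%:~R * eps + (cc j)%:~R).

(** On the line [cc + eps * bb] of kernel vectors the coordinates off [I] are
    multiples of [eps], so that, the sum of [bb] off [I] being positive, a
    monomial carries the higher a power of [eps] the higher its power of [z2].
    The lowest power comes from the constant term of [g] alone, which is a
    unit. *)
Lemma rehom_kernel_line_neq0 (cc bb : 'I_n -> int) C1 C2 (t S : nat)
    (g : {poly {poly K}}) : circuit_frame A I cc bb C1 C2 ->
  (forall (m k : nat) j, (k < S)%N -> (m < S)%N ->
     0 <= t%:Z + cc j * m%:Z + bb j * k%:Z) ->
  (0 < S)%N -> g`_0 \is a GRing.unit ->
  ~ forall eps, eval (rehom cc bb (fun=> t%:Z) S g) (kernel_line cc bb eps) = 0.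
Proof.
move=> F v0 S0 gu h0.
pose l m k j := lexp cc bb (fun=> t%:Z) m k j.
have cz j : j \notin I -> cc j = 0 by rewrite -(frame_supp F) negbK => /eqP.
pose be := absz (\sum_(j | j \notin I) bb j).
have beE : be%:Z = \sum_(j | j \notin I) bb j by rewrite gtz0_abs // (frame_pos F).
have be0 : (0 < be)%N by rewrite -ltz_nat beE (frame_pos F).
pose s0 := (\sum_(j | j \notin I) t)%N.
have sl m k : (k < S)%N -> (m < S)%N ->
    (\sum_(j | j \notin I) l m k j = s0 + be * k)%N.
  move=> lk lm; apply/eqP; rewrite -eqz_nat PoszD PoszM beE /s0.
  rewrite !(big_morph Posz PoszD (erefl _)) mulr_suml -big_split.
  apply/eqP; apply: eq_bigr => j jI; rewrite /l (lexpE v0) // cz //=; ring.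
pose R m k : {poly K} := (\prod_(j in I) linp K (bb j) (cc j) ^+ l m k j)
  * (\prod_(j | j \notin I) (bb j)%:~R ^+ l m k j)%:P.
pose G := \sum_(k < S) \sum_(m < S) (g`_k`_m)%:P * R m k * 'X^(be * k).
have Geval eps : ('X^s0 * G).[eps] = 0.
  rewrite -(h0 eps) hornerM hornerXn horner_sum mulr_sumr /eval /rehom rmorph_sum.
  apply: eq_bigr => k _; rewrite horner_sum mulr_sumr rmorph_sum.
  apply: eq_bigr => m _; rewrite /= mevalZ mevalX !hornerM hornerC hornerXn hornerC.
  rewrite [RHS](_ : _ = g`_k`_m * (\prod_(j in I) (kernel_line cc bb eps 0 j) ^+ l m k j
     * \prod_(j | j \notin I) (kernel_line cc bb eps 0 j) ^+ l m k j)); last first.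
    by congr (_ * _); rewrite [LHS](bigID [in I]).
  have -> : \prod_(j | j \notin I) (kernel_line cc bb eps 0 j) ^+ l m k j
      = (\prod_(j | j \notin I) (bb j)%:~R ^+ l m k j) * (eps ^+ s0 * eps ^+ (be * k)).
    rewrite -exprD -(sl m k (ltn_ord k) (ltn_ord m)) -[in RHS]prodrXr -big_split.
    by apply: eq_bigr => j jI; rewrite mxE cz // addr0 exprMn.
  have -> : \prod_(j in I) (kernel_line cc bb eps 0 j) ^+ l m k j
      = (\prod_(j in I) linp K (bb j) (cc j) ^+ l m k j).[eps].
    rewrite horner_prod; apply: eq_bigr => j _.
    by rewrite horner_exp linpE mxE.
  by ring.
have G0 : G = 0.
  have : 'X^s0 * G = 0 by apply: (@poly_nat_roots _ _ 0%N) => m _.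
  by move/eqP; rewrite mulf_eq0 expf_eq0 polyX_eq0 andbF /= => /eqP.
have := congr1 (horner^~ 0) G0; rewrite /= horner0 /G horner_sum.
rewrite (bigD1 (Ordinal S0)) //= [X in _ + X]big1 ?addr0 => [|k nk]; last first.
  rewrite horner_sum big1 // => m _; rewrite hornerM hornerXn expr0n muln_eq0.
  rewrite (gtn_eqF be0) /=; case: eqP => [e|_]; last by rewrite mulr0.
  by case/eqP: nk; apply/val_inj.
move: gu; rewrite poly_unitE => /andP[/eqP sz1 u0].
rewrite horner_sum (bigD1 (Ordinal S0)) //= big1 ?addr0 => [|m nm]; last first.
  rewrite nth_default ?mul0r ?horner0 ?polyC0 ?mul0r ?horner0 // sz1.
  by case: m nm => [[|m] lt] //= /eqP[]; apply/val_inj.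
rewrite muln0 expr0 mulr1 hornerM hornerC => /eqP; apply/negP.
rewrite mulf_neq0 //; first by apply: contraTneq u0 => ->; rewrite unitr0.
rewrite /R hornerM hornerC mulf_neq0 //.
  rewrite horner_prod; apply/prodf_neq0 => j jI.
  by rewrite horner_exp linpE mulr0 add0r expf_neq0 // intr_eq0 (frame_supp F).
by apply/prodf_neq0 => j jI; rewrite expf_neq0 // intr_eq0 (frame_bb F).
Qed.

(** Take the monomial of [b] that is lowest for [C2], then for [C1]; adding a
    large multiple of [C2] to [C1] makes it lowest for both. *)
Lemma frame_lowest cc bb C1 C2 (b : mpoly n K) :
  circuit_frame A I cc bb C1 C2 -> b != 0 ->
  exists bb' C1' u0, [/\ circuit_frame A I cc bb' C1' C2, u0 \in msupp b &
    forall u, u \in msupp b -> (wgt C1' u0 <= wgt C1' u)%N /\ (wgt C2 u0 <= wgt C2 u)%N].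
Proof.
move=> F b0.
have ex2 : exists k, has (fun u => wgt C2 u == k) (msupp b).
  by exists (wgt C2 (mlead b)); apply/hasP; exists (mlead b); rewrite ?mlead_supp.
pose k0 := ex_minn ex2.
have min2 u : u \in msupp b -> (k0 <= wgt C2 u)%N.
  by move=> hu; rewrite /k0; case: ex_minnP => k _; apply; apply/hasP; exists u.
have ex1 : exists m, has (fun u => (wgt C2 u == k0) && (wgt C1 u == m)) (msupp b).
  have /hasP[u hu /eqP e] : has (fun u => wgt C2 u == k0) (msupp b).
    by rewrite /k0; case: ex_minnP.
  by exists (wgt C1 u); apply/hasP; exists u; rewrite ?e ?eqxx.
pose m0 := ex_minn ex1.
have /hasP[u0 hu0 /andP[/eqP e2 /eqP e1]] :
    has (fun u => (wgt C2 u == k0) && (wgt C1 u == m0)) (msupp b).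
  by rewrite /m0; case: ex_minnP.
have min1 u : u \in msupp b -> wgt C2 u = k0 -> (m0 <= wgt C1 u)%N.
  move=> hu e; rewrite /m0; case: ex_minnP => m _; apply; apply/hasP.
  by exists u; rewrite // e !eqxx.
exists (fun j => bb j - m0%:Z * cc j), (fun j => C1 j + m0 * C2 j)%N, u0.
split=> //; first exact: frame_shear.
have wE u : wgt (fun j => C1 j + m0 * C2 j)%N u = (wgt C1 u + m0 * wgt C2 u)%N.
  rewrite /wgt big_distrr -big_split; apply: eq_bigr => j _ /=.
  by rewrite mulnDl mulnA.
move=> u hu; rewrite !wE e1 e2; split; last exact: min2.
have := min2 u hu; rewrite leq_eqVlt => /predU1P[e|lt].
  by rewrite -e leq_add2r min1.
apply: leq_trans (leq_addl _ _).
by apply: leq_trans (leq_mul (leqnn m0) lt); rewrite mulnS.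
Qed.

End Conclusion.

Section Main.

Variables (K : numFieldType) (d n : nat) (A : 'M[int]_(d, n)).
Variables (I : {set 'I_n}).

Lemma degA_kappa cc bb C1 C2 (u v : multinom n) : circuit_frame A I cc bb C1 C2 ->
  (forall i, degA A i u = degA A i v) ->
  forall j, kappa cc bb C1 C2 j u = kappa cc bb C1 C2 j v.
Proof.
move=> F e j.
have hw : forall i, \sum_j A i j * ((u j)%:Z - (v j)%:Z) = 0.
  move=> i; under eq_bigr => l _ do rewrite mulrBr.
  by rewrite sumrB; apply/eqP; rewrite subr_eq0; apply/eqP/e.
have := frame_ker F hw j.
have wE (C : 'I_n -> nat) : \sum_l (C l)%:Z * ((u l)%:Z - (v l)%:Z)
    = (wgt C u)%:Z - (wgt C v)%:Z.
  rewrite /wgt !(big_morph Posz PoszD (erefl _)) -sumrB.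
  by apply: eq_bigr => l _; rewrite !PoszM mulrBr.
rewrite !wE /kappa => h; apply/eqP; rewrite -subr_eq0; apply/eqP.
transitivity ((u j)%:Z - (v j)%:Z - (cc j * ((wgt C1 u)%:Z - (wgt C1 v)%:Z)
   + bb j * ((wgt C2 u)%:Z - (wgt C2 v)%:Z))); first by ring.
by rewrite -h subrr.
Qed.

Lemma circuit_word_deriv (cc : 'I_n -> int) (S : pred 'I_n) :
  circuit_word cc S = deriv_word (\col_j (if S j then absz (cc j) else 0%N)).
Proof.
rewrite /circuit_word /deriv_word; congr flatten; apply: eq_map => j.
by rewrite mxE.
Qed.

Lemma dehom_lowest cc bb C1 C2 (b : mpoly n K) kQ u0 :
  homog cc bb C1 C2 b kQ -> u0 \in msupp b ->
  (forall u, u \in msupp b -> (wgt C1 u0 <= wgt C1 u)%N /\ (wgt C2 u0 <= wgt C2 u)%N) ->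
  exists2 q, dehom C1 C2 b = zmon K (wgt C1 u0) (wgt C2 u0) * q & q`_0`_0 != 0.
Proof.
move=> hb hu0 lo.
pose q := \sum_(u <- msupp b) (mcoeff u b)%:P%:P
  * zmon K (wgt C1 u - wgt C1 u0)%N (wgt C2 u - wgt C2 u0)%N.
have e : dehom C1 C2 b = zmon K (wgt C1 u0) (wgt C2 u0) * q.
  rewrite dehomE mulr_sumr big_seq [RHS]big_seq; apply: eq_bigr => u hu.
  by have [l1 l2] := lo u hu; rewrite [RHS]mulrCA zmonM !subnKC.
exists q => //; have := coef_dehom hb hu0; rewrite e /zmon -mulrA.
rewrite coefCM coefXnM ltnn subnn coefXnM ltnn subnn => ->.
by rewrite -mcoeff_msupp.
Qed.

(** The denominator of the function divides the rehomogenization of a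
    polynomial with unit constant term, which does not vanish on the kernel of
    [A]. *)
Theorem unbalanced_not_gkz_rational (B : 'M[int]_(n, 2)) : (2 <= n)%N ->
  nonconfluent A -> ~ all_but_one_on_hyperplane A -> gale_dual A B ->
  circuit A I -> ~ balanced A I -> ~ splitting B I ->
  ~ gkz_rational K A.
Proof.
move=> n2 nc nH AB cI unb nspl [D discD [nmD [alpha
  [P [Q [U [P0 PQ DQ [Une Q0U] hyp]]]]]]].
have QZ x : singular_locus A x -> eval Q x = 0.
  case: discD => [[_ [_ DZ]]|[_ D1]]; last first.
    by case: nmD; exists 1, (@mnm0 n); rewrite D1 mpolyX0 scale1r.
  have [g ->] := DQ => sx; rewrite evalM DZ ?mulr0 //.
  by move=> p; apply.
have Q0 : Q != 0.
  have [x Ux] := Une; apply: contraNneq (Q0U x Ux) => ->.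
  by rewrite /eval meval0.
have hE := hypergeometric_euler Une Q0U hyp.
have [a [b [ga [eab b0 a0 hb ha]]]] := homogeneous_fraction Q0 P0 hE.
have [cc [bb0 [C10 [C2 F0]]]] := circuit_frame_exists n2 AB nc nH cI unb nspl.
have [bb [C1 [u0 [F hu0 lo]]]] := frame_lowest F0 b0.
(* Degrees for the torus action are degrees transverse to [cc] and [bb]. *)
pose kQ j := kappa cc bb C1 C2 j u0.
pose kP j := kappa cc bb C1 C2 j (mlead a).
have hQ : homog cc bb C1 C2 b kQ.
  by move=> u hu j; apply: degA_kappa F _ j => i; rewrite !hb.
have hP : homog cc bb C1 C2 a kP.
  by move=> u hu j; apply: degA_kappa F _ j => i; rewrite !ha // mlead_supp.
have [q eq q00] := dehom_lowest hQ hu0 lo.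
have box : numer a b (circuit_word cc [pred j | 0 < cc j])
    = numer a b (circuit_word cc [pred j | cc j < 0]).
  rewrite !circuit_word_deriv.
  apply: (hypergeometric_numer Une Q0U hyp eab b0); last first.
    by rewrite -!circuit_word_deriv (size_pos_neg (frame_cc F)).
  apply/matrixP => i k; rewrite ord1 !mxE; apply/eqP; rewrite -subr_eq0 -sumrB.
  apply/eqP; rewrite -[RHS](frame_Acc F i); apply: eq_bigr => j _.
  by rewrite !mxE -mulrBr pos_neg.
have [p2 [q2 [q2u e2]]] := circuit_fatou (frame_C1cc F) (frame_C2cc F) hP hQ eq q00
  (frame_cc F) box (frame_unb F).
pose e := expo cc bb kP kQ (wgt C1 u0) (wgt C2 u0).
have [S1 hS1] := bounded_exists p2; have [S2 hS2] := bounded_exists q2.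
pose S := (S1 + S2).+1.
have bp2 : bounded_by S p2 by apply: hS1; rewrite /S; lia.
have bq2 : bounded_by S q2 by apply: hS2; rewrite /S; lia.
(* [P / Q] is [x ^ e] times a function of [z1] and [z2]; the translation by [t]
   makes all exponents nonnegative. *)
pose t := (\sum_j (absz (e j) + S * (absz (cc j) + absz (bb j))))%N.
have tge j : (absz (e j) + S * (absz (cc j) + absz (bb j)) <= t)%N.
  by rewrite /t (bigD1 j) //= leq_addr.
have tE (x : int) (m k : nat) j : (absz x <= absz (e j))%N -> (k < S)%N -> (m < S)%N ->
    0 <= t%:Z + x + cc j * m%:Z + bb j * k%:Z.
  move=> lx lk lm; have := tge j; rewrite mulnDr => tj.
  have h1 : (absz (cc j * m%:Z)%R <= S * absz (cc j))%N.
    by rewrite abszM mulnC leq_mul2r ltnW ?orbT.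
  have h2 : (absz (bb j * k%:Z)%R <= S * absz (bb j))%N.
    by rewrite abszM mulnC leq_mul2r ltnW ?orbT.
  move: (cc j * m%:Z) (bb j * k%:Z) (S * absz (cc j))%N (S * absz (bb j))%N h1 h2 tj.
  by move: (absz (e j)) lx; clear; lia.
have v1 (m k : nat) j : (k < S)%N -> (m < S)%N ->
    0 <= (fun=> t%:Z) j + cc j * m%:Z + bb j * k%:Z.
  by move=> lk lm; have := tE 0 m k j isT lk lm; rewrite addr0.
have v2 (m k : nat) j : (k < S)%N -> (m < S)%N ->
    0 <= (fun j => t%:Z + e j) j + cc j * m%:Z + bb j * k%:Z.
  by move=> lk lm; apply: tE.
pose Q' : mpoly n K := rehom cc bb (fun=> t%:Z) S q2.
pose P' : mpoly n K := rehom cc bb (fun j => t%:Z + e j) S p2.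
have eE j : e j = (mlead a j)%:Z - cc j * (wgt C1 (mlead a))%:Z
    - bb j * (wgt C2 (mlead a))%:Z - (u0 j)%:Z.
  by rewrite /e /expo /kP /kQ /kappa; ring.
have Ce (C : 'I_n -> nat) : \sum_j (C j)%:Z * e j = (wgt C (mlead a))%:Z
    - (\sum_j (C j)%:Z * cc j) * (wgt C1 (mlead a))%:Z
    - (\sum_j (C j)%:Z * bb j) * (wgt C2 (mlead a))%:Z - (wgt C u0)%:Z.
  have wE u : (wgt C u)%:Z = \sum_j (C j * u j)%N%:Z.
    exact: (big_morph Posz PoszD (erefl _)).
  rewrite (wE (mlead a)) (wE u0) !mulr_suml -!sumrB.
  by apply: eq_bigr => j _; rewrite eE !PoszM; ring.
have C1e : \sum_j (C1 j)%:Z * e j = - (wgt C1 u0)%:Z.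
  by rewrite Ce (frame_C1cc F) (frame_C1bb F); ring.
have C2e : \sum_j (C2 j)%:Z * e j = - (wgt C2 u0)%:Z.
  by rewrite Ce (frame_C2cc F) (frame_C2bb F); ring.
pose T1 := (\sum_j C1 j * t)%N; pose T2 := (\sum_j C2 j * t)%N.
have TE (C : 'I_n -> nat) : \sum_j (C j)%:Z * t%:Z = (\sum_j C j * t)%N%:Z.
  by rewrite (big_morph Posz PoszD (erefl _)); apply: eq_bigr => j _; rewrite PoszM.
have TeE (C : 'I_n -> nat) : \sum_j (C j)%:Z * (t%:Z + e j)
    = (\sum_j C j * t)%N%:Z + \sum_j (C j)%:Z * e j.
  by rewrite -TE -big_split; apply: eq_bigr => j _; rewrite mulrDr.
have dQ' : dehom C1 C2 Q' = zmon K T1 T2 * q2.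
  have z1 : zmon K 0 0 = 1 by rewrite /zmon !expr0 mulr1.
  rewrite -[LHS]mul1r -z1; apply: (dehom_rehom (frame_C1cc F) (frame_C1bb F)
    (frame_C2cc F) (frame_C2bb F) v1 bq2); by rewrite addr0 TE.
have dP' : zmon K (wgt C1 u0) (wgt C2 u0) * dehom C1 C2 P' = zmon K T1 T2 * p2.
  apply: (dehom_rehom (frame_C1cc F) (frame_C1bb F)
    (frame_C2cc F) (frame_C2bb F) v2 bp2).
    by rewrite TeE C1e addrNK.
  by rewrite TeE C2e addrNK.
(* Both sides have the same degree and the same restriction to the torus. *)
have eQP : Q' * a = P' * b.
  have hQ' := homog_rehom (g := q2) (frame_C1cc F) (frame_C1bb F) (frame_C2cc F)
    (frame_C2bb F) v1.
  have hP' := homog_rehom (g := p2) (frame_C1cc F) (frame_C1bb F) (frame_C2cc F)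
    (frame_C2bb F) v2.
  have h1 := homogM hQ' hP; have h2 := homogM hP' hQ.
  apply: (dehom_inj h1); first apply: homog_eq h2 => j.
    by rewrite !TeE !TE C1e C2e /e /expo; ring.
  rewrite !dehomM dQ' eq; move: e2 dP'.
  move: (dehom C1 C2 a) (dehom C1 C2 P') (zmon K T1 T2) (zmon K _ _) => x y z z' ex ez.
  have -> : z * q2 * x = z * (q2 * x) by ring.
  have -> : y * (z' * q) = z' * y * q by ring.
  by rewrite ex ez mulrA.
have QQ' : divides Q Q'.
  have euclid := @lowest_terms_dvd _ P Q Q' (@factorial_mpoly n K) PQ Q0.
  apply: euclid; exists P'.
  by apply: (mulIf b0); rewrite -mulrA -eab mulrCA eQP; ring.
apply: (rehom_kernel_line_neq0 F v1 _ q2u) => // eps.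
have [h eh] := QQ'; rewrite -/Q' eh evalM QZ ?mulr0 //.
apply: kernel_singular_locus => [i|].
  transitivity ((\sum_j A i j * bb j)%:~R * eps + (\sum_j A i j * cc j)%:~R : K).
    rewrite !rmorph_sum mulr_suml -big_split; apply: eq_bigr => j _ /=.
    by rewrite mxE !rmorphM /=; ring.
  by rewrite (frame_Abb F) (frame_Acc F) mul0r addr0.
transitivity ((\sum_j bb j)%:~R * eps + (\sum_j cc j)%:~R : K).
  rewrite !rmorph_sum mulr_suml -big_split; apply: eq_bigr => j _ /=.
  by rewrite mxE.
by rewrite (frame_bb0 F) (frame_cc F) mul0r addr0.
Qed.

End Main.

Close Scope ring_scope.
Close Scope classical_set_scope.
Unset Implicit Arguments.

Theorem theorem3p3 (R : realType) (d : nat)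
    (A : 'M[int]_(d, d + 2)) (B : 'M[int]_(d + 2, 2)) (I : {set 'I_(d + 2)}) :
  spanning A ->
  nonconfluent A ->
  ~ all_but_one_on_hyperplane A ->
  distinct_points A ->
  gale_dual A B ->
  circuit A I -> ~ balanced A I -> ~ splitting B I ->
  ~ gkz_rational (complex R) A.
Proof.
move=> _ nc nH _ AB cI unb nspl.
by apply: unbalanced_not_gkz_rational AB cI unb nspl; rewrite ?leq_addl.
Qed.
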